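(* Let $N\ge1$ be an integer. The Birkhoff polytope $\Pi_N$ is monotone for $1\le N\le4$ but not monotone for $N\ge5$. In particular, when $N\ge5$, for some costs $\hat c:\mathbb{R}^D\times\mathbb{R}^D\to\mathbb{R}$ the optimal support $\eta\mapsto\operatorname{spt}(\gamma_{\eta,\hat c})$ is not monotone decreasing (for inclusion).
   Context: The Birkhoff polytope is $\Pi_N=\{\pi\in\mathbb{R}^{N\times N}:\sum_{i}\pi_{i,j}=1\ \forall j,\ \sum_{j}\pi_{i,j}=1\ \forall i,\ \pi_{i,j}\ge0\}$. $\mathbb{R}^{N\times N}$ carries the Frobenius inner product $\langle A,B\rangle=\sum_{i,j}a_{ij}b_{ij}$ with induced norm $\|\cdot\|$. Faces: a face of a polytope $\mathcal{P}$ is a convex subset $F\subset\mathcal{P}$ such that any open line segment $L=(x,y)\subset\mathcal{P}$ with $L\cap F\neq\emptyset$ satisfies $[x,y]\subset F$. Monotonicity: for a nonempty polytope $\mathcal{P}$ in a Euclidean space and a vector $c$ in that space, let $x_\eta=\operatorname{proj}_{\mathcal{P}}(-\eta c)$ for $\eta\in[0,\infty)$, where $\operatorname{proj}_{\mathcal{P}}$ is the nearest-point projection (for $\eta>0$, $x_\eta$ is the unique minimizer of $\langle c,x\rangle+\frac1{2\eta}\|x\|^2$ over $\mathcal{P}$), and $x_\infty=\lim_{\eta\to\infty}x_\eta$. $\mathcal{P}$ is $c$-monotone if for any face $F$ of $\mathcal{P}$, $x_\eta\in F$ implies $x_{\eta'}\in F$ for all $\eta'\ge\eta$ in $[0,\infty]$.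 $\mathcal{P}$ is monotone if it is $c$-monotone for all $c$. Optimal transport: fix two sets of $N$ distinct points $\{X_1,\dots,X_N\}\subset\mathbb{R}^D$ and $\{Y_1,\dots,Y_N\}\subset\mathbb{R}^D$ ($D\ge1$), and let $\mu=\frac1N\sum_i\delta_{X_i}$, $\nu=\frac1N\sum_i\delta_{Y_i}$. $\Gamma(\mu,\nu)$ is the set of couplings, i.e., probability measures on $\mathbb{R}^D\times\mathbb{R}^D$ with marginals $\mu$ and $\nu$; each is of the form $\gamma=\sum_{i,j}\gamma_{i,j}\delta_{(X_i,Y_j)}$. For $\hat c:\mathbb{R}^D\times\mathbb{R}^D\to\mathbb{R}$ and $\eta\in(0,\infty)$, $\gamma_{\eta,\hat c}$ is the unique minimizer over $\gamma\in\Gamma(\mu,\nu)$ of $\int\hat c(x,y)\,d\gamma(x,y)+\frac1{2\eta}\left\|\frac{d\gamma}{d(\mu\otimes\nu)}\right\|^2_{L^2(\mu\otimes\nu)}$. Its support is $\operatorname{spt}\gamma=\{(X_i,Y_j):\gamma_{i,j}>0\}$. Monotone decreasing means $\operatorname{spt}\gamma_{\eta',\hat c}\subset\operatorname{spt}\gamma_{\eta,\hat c}$ whenever $\eta\le\eta'$. *)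

(* Defs.v *)
From HB Require Import structures.
From mathcomp Require Import all_boot all_order all_algebra.
From mathcomp Require Import all_classical all_reals all_analysis.

Set Implicit Arguments.
Unset Strict Implicit.
Unset Printing Implicit Defensive.

Import Order.TTheory GRing.Theory Num.Theory.
Import numFieldNormedType.Exports.

Local Open Scope classical_set_scope.
Local Open Scope ring_scope.

Section Polytopes.
Context (R : realType) (m n : nat).
Local Notation V := 'M[R]_(m, n).
Implicit Types (P F : set V) (c x y z : V).

Definition frob_inner (A B : V) : R := \sum_i \sum_j A i j * B i j.

(* The library's norm on matrices is the sup norm; it only serves, below, to
   provide the topology. *)
Definition frob_norm (A : V) : R := Num.sqrt (frob_inner A A).

Definition open_segment x y : set V :=
  [set (1 - t) *: x + t *: y | t in `]0, 1[].

Definition closed_segment x y : set V :=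
  [set (1 - t) *: x + t *: y | t in `[0, 1]].

Definition is_face P F : Prop :=
  [/\ convex_set (F : set (convex_lmodType V)), F `<=` P &
      forall x y, open_segment x y `<=` P -> open_segment x y `&` F !=set0 ->
        closed_segment x y `<=` F].

Definition is_nearest_point P z x : Prop :=
  P x /\ forall y, P y -> frob_norm (x - z) <= frob_norm (y - z).

Definition proj P z : V := get [set x | is_nearest_point P z x].

(* The value at -oo is never used: [c_monotone] only looks at [0, +oo]. *)
Definition proj_curve P c (eta : \bar R) : V :=
  match eta with
  | r%:E => proj P (- (r *: c))
  | +oo%E => lim (proj P (- (r *: c)) @[r --> +oo])
  | -oo%E => 0
  end.

Definition c_monotone P c : Prop :=
  forall F, is_face P F ->
  forall eta eta' : \bar R, (0 <= eta)%E -> (eta <= eta')%E ->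
    F (proj_curve P c eta) -> F (proj_curve P c eta').

Definition monotone_polytope P : Prop := forall c, c_monotone P c.

End Polytopes.

Definition birkhoff (R : realType) (N : nat) : set 'M[R]_N :=
  [set p | [/\ forall j, \sum_i p i j = 1, forall i, \sum_j p i j = 1 &
               forall i j, 0 <= p i j]].

Section Empirical.
Context d (T : measurableType d) (R : realType) (N : nat) (X : 'I_N -> T).
Local Open Scope ereal_scope.

Definition empirical (A : set T) : \bar R :=
  (N%:R^-1)%R%:E * \sum_(i < N) \d_(X i) A.

Let empirical0 : empirical set0 = 0.
Proof.
by rewrite /empirical big1 ?mule0// => i _; rewrite measure0.
Qed.

Let empirical_ge0 A : 0 <= empirical A.
Proof.
by rewrite /empirical mule_ge0 ?lee_fin ?invr_ge0// sume_ge0.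
Qed.

Let atom (k : nat) : {measure set T -> \bar R} :=
  if insub k is Some i then \d_(X i) else mzero.

Let weight_ge0 : (0 <= N%:R^-1 :> R)%R. Proof. by rewrite invr_ge0. Qed.

Let empiricalE : empirical = mscale (NngNum weight_ge0) (msum atom N).
Proof.
apply/funext => A; rewrite /empirical /mscale /msum/=.
congr (_ * _); apply: eq_bigr => i _.
by rewrite /atom valK.
Qed.

Let empirical_sigma_additive : semi_sigma_additive empirical.
Proof. by rewrite empiricalE; exact: measure_semi_sigma_additive. Qed.

HB.instance Definition _ := isMeasure.Build _ _ _ empirical
  empirical0 empirical_ge0 empirical_sigma_additive.

Let empirical_finite : fin_num_fun empirical.
Proof.
move=> A mA; rewrite /empirical fin_numM// sum_fin_num//.
by apply/allP => x /mapP[i _ ->]; rewrite diracE.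
Qed.

HB.instance Definition _ := Measure_isFinite.Build _ _ _ empirical
  empirical_finite.

End Empirical.

Section ProductFinite.
Context d1 d2 (T1 : measurableType d1) (T2 : measurableType d2) (R : realType).
Variables (mu : {finite_measure set T1 -> \bar R})
          (nu : {finite_measure set T2 -> \bar R}).
Local Open Scope ereal_scope.

(* [mu \x nu] itself: the name is only there to carry the finite measure
   structure, as the library's finite and sigma-finite instances on [\x] are
   found by unification for subprobabilities only. *)
Definition product_finite : set (T1 * T2) -> \bar R := mu \x nu.

HB.instance Definition _ := Measure.on product_finite.

Let product_finite_fin : fin_num_fun product_finite.
Proof.
apply: lty_fin_num_fun.
rewrite [ltLHS](_ : _ = mu setT * nu setT); last first.
  by rewrite -product_measure1E// setXTT.
by rewrite lte_mul_pinfty// ?ltey_eq ?fin_num_measure.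
Qed.

HB.instance Definition _ :=
  Measure_isFinite.Build _ _ _ product_finite product_finite_fin.

End ProductFinite.

Section Coupling.
Context d1 d2 (T1 : measurableType d1) (T2 : measurableType d2) (R : realType).
Variables (mu : {finite_measure set T1 -> \bar R})
          (nu : {finite_measure set T2 -> \bar R}).
Local Open Scope ereal_scope.
Local Open Scope charge_scope.

Definition coupling : set (probability (T1 * T2)%type R) :=
  [set g | (forall A, measurable A -> pushforward g fst A = mu A) /\
           (forall B, measurable B -> pushforward g snd B = nu B)].

Definition qot_objective (c : T1 -> T2 -> R) (eta : R)
    (g : probability (T1 * T2)%type R) : \bar R :=
  (\int[g]_z (c z.1 z.2)%:E) +
  ((2 * eta)^-1)%R%:E *
    'N[product_finite mu nu]_2%:E
      ['d (charge_of_finite_measure g) '/d (product_finite mu nu)] ^+ 2.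

Definition is_qot_minimizer (c : T1 -> T2 -> R) (eta : R)
    (g : probability (T1 * T2)%type R) : Prop :=
  coupling g /\
  forall g', coupling g' -> qot_objective c eta g <= qot_objective c eta g'.

(* Minimizers are unique as measures, that is, on measurable sets; [probability]
   also records values on the other sets, so [get] may have several candidates.
   They give the same mass to measurable singletons, which is all that
   [atomic_support] below looks at. *)
Definition qot_plan (c : T1 -> T2 -> R) (eta : R) :
    probability (T1 * T2)%type R :=
  get [set g | is_qot_minimizer c eta g].

End Coupling.

Section DiscreteTransport.
Context d1 d2 (T1 : measurableType d1) (T2 : measurableType d2) (R : realType).
Context (N : nat) (X : 'I_N -> T1) (Y : 'I_N -> T2).

Definition atomic_support (g : set (T1 * T2) -> \bar R) : set (T1 * T2) :=
  [set z | exists i j, z = (X i, Y j) /\ (0 < g [set (X i, Y j)])%E].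

Definition optimal_support (c : T1 -> T2 -> R) (eta : R) : set (T1 * T2) :=
  atomic_support (qot_plan (empirical R X) (empirical R Y) c eta).

Definition support_decreasing (c : T1 -> T2 -> R) : Prop :=
  forall eta eta' : R, 0 < eta -> eta <= eta' ->
    optimal_support c eta' `<=` optimal_support c eta.

End DiscreteTransport.

(* Main.v *)
Require Import Defs.
From mathcomp Require Import all_boot all_order all_fingroup all_algebra.
From mathcomp Require Import all_classical all_reals all_analysis.
From mathcomp Require Import measurable_realfun ring lra.

Set Implicit Arguments.
Unset Strict Implicit.
Unset Printing Implicit Defensive.

Import Order.TTheory GRing.Theory Num.Theory.
Import numFieldNormedType.Exports.

(* For [N <= 4], let [x_t] be the projection of [- t c]. While its support [S] is
   constant, [x_t / t] is affine in [1 / t] and its slope [D] is the point of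
   minimal norm of the affine hull of the face given by [S]. If [D >= 0] for every
   such [S], the entries of [x_t / t] cannot increase with [t], so an entry that
   vanishes keeps vanishing; as there are finitely many supports, it is enough to
   compare times with the same support accumulating on the right of the last zero.
   Along a perfect matching of [S] through [(i, j)], [D i j] is the total potential
   drop of the unit current from row [i] to column [j] in the bipartite graph [S]
   with unit resistances. In the other pairs of the matching the column may have
   the higher potential, but with at most three such pairs these rises do not
   exceed the drop from [i] to [j].
   For [N >= 5], on the support made of one row, the same column and the diagonal,
   [D] is negative at the corner, and a ray through a matrix vanishing there leaves
   the corresponding facet. The regularized transport problem is the projection
   problem up to scaling, the plan being [1 / N] times a doubly stochastic matrix. *)

Local Open Scope classical_set_scope.
Local Open Scope ring_scope.

(** * Unit electrical flows *)

Section Electrical.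
Variables (R : realFieldType) (n : nat) (w : 'M[R]_n).
Hypothesis w_sym : forall x y, w x y = w y x.
Hypothesis w_ge0 : forall x y, 0 <= w x y.

Definition laplacian (h : 'I_n -> R) x := \sum_y w x y * (h x - h y).

(** Kirchhoff's law for the conductances [w]: a unit current enters at [p] and leaves at [q]. *)
Definition unit_potential p q (h : 'I_n -> R) :=
  forall x, laplacian h x = (x == p)%:R - (x == q)%:R.

(** Summation by parts: the sum over ordered pairs counts every edge twice, hence the factor 2. *)
Lemma dirichlet_form (f h : 'I_n -> R) :
  (\sum_x f x * laplacian h x) *+ 2 =
  \sum_x \sum_y w x y * (f x - f y) * (h x - h y).
Proof.
have E1 : \sum_x f x * laplacian h x =
    \sum_x \sum_y w x y * f x * (h x - h y).
  apply: eq_bigr => x _; rewrite mulr_sumr; apply: eq_bigr => y _; ring.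
have E2 : \sum_x f x * laplacian h x =
    \sum_x \sum_y - (w x y * f y * (h x - h y)).
  rewrite E1 exchange_big/=; apply: eq_bigr => x _; apply: eq_bigr => y _.
  rewrite w_sym; ring.
rewrite mulr2n {1}E1 E2 -big_split/=; apply: eq_bigr => x _.
rewrite -big_split/=; apply: eq_bigr => y _; ring.
Qed.

Lemma sum_unit_charge (f : 'I_n -> R) p q :
  \sum_x f x * ((x == p)%:R - (x == q)%:R) = f p - f q.
Proof.
under eq_bigr do rewrite mulrBr.
rewrite sumrB; congr (_ - _).
  by rewrite (bigD1 p)//= eqxx mulr1 big1 ?addr0// => x /negPf->; rewrite mulr0.
by rewrite (bigD1 q)//= eqxx mulr1 big1 ?addr0// => x /negPf->; rewrite mulr0.
Qed.

(* The Laplacian is symmetric, so its range is the orthogonal of its kernel, and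
   vectors in the kernel have zero energy, hence agree at [p] and [q]. *)
Lemma unit_potential_exists p q : 0 < w p q -> exists h, unit_potential p q h.
Proof.
move=> wpq.
pose L : 'M[R]_n := \matrix_(x, y) ((x == y)%:R * (\sum_z w x z) - w x y).
pose b : 'rV[R]_n := \row_x ((x == p)%:R - (x == q)%:R).
have LE (h : 'I_n -> R) x : \sum_y h y * L y x = laplacian h x.
  rewrite /laplacian; under [RHS]eq_bigr do rewrite mulrBr.
  under [LHS]eq_bigr => y _ do rewrite mxE mulrBr.
  rewrite !sumrB; congr (_ - _).
    rewrite (bigD1 x)//= eqxx mul1r [X in _ + X]big1 ?addr0; last first.
      by move=> y /negPf->; rewrite mul0r mulr0.
    by rewrite mulr_sumr; apply: eq_bigr => y _; rewrite mulrC.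
  by apply: eq_bigr => y _; rewrite w_sym mulrC.
have L_sym x y : L x y = L y x.
  by rewrite !mxE w_sym eq_sym; case: eqP => [->//|]; rewrite !mul0r.
suff /submxP[h bE] : (b <= L)%MS.
  exists (h 0) => x; rewrite -LE.
  by move/matrixP/(_ 0 x): bE; rewrite !mxE => ->.
rewrite submxE; apply/eqP/matrixP => i j; rewrite !mxE.
pose k x := cokermx L x j.
have lapk x : laplacian k x = 0.
  have /matrixP/(_ x j) := mulmx_coker L; rewrite !mxE => Lk0.
  by rewrite -LE -[RHS]Lk0; apply: eq_bigr => y _; rewrite mulrC L_sym.
have := dirichlet_form k k.
rewrite big1 => [|x _]; last by rewrite lapk mulr0.
rewrite mul0rn => /esym/eqP; rewrite psumr_eq0; last first.
  by move=> x _; apply: sumr_ge0 => y _; rewrite -mulrA -expr2 mulr_ge0// sqr_ge0.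
move=> /allP/(_ p (mem_index_enum _)); rewrite implyTb psumr_eq0; last first.
  by move=> y _; rewrite -mulrA -expr2 mulr_ge0// sqr_ge0.
move=> /allP/(_ q (mem_index_enum _)); rewrite implyTb.
rewrite !mulf_eq0 (gt_eqF wpq)/= orbb subr_eq0 => /eqP kpq.
under eq_bigr => x _ do rewrite mxE mulrC -/(k x).
by rewrite sum_unit_charge kpq subrr.
Qed.

Lemma unit_potential_le p q h : unit_potential p q h -> h q <= h p.
Proof.
move=> hP; have := dirichlet_form h h.
under eq_bigr do rewrite hP.
rewrite sum_unit_charge -subr_ge0 => E.
rewrite -(@pmulrn_lge0 _ _ 2)// E.
apply: sumr_ge0 => x _; apply: sumr_ge0 => y _.
by rewrite -mulrA -expr2 mulr_ge0// sqr_ge0.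
Qed.

(* [f := max (h - h p) 0] vanishes at both poles, so its energy against [h] is
   zero, hence [f] is locally constant. *)
Lemma unit_potential_min p q h : unit_potential p q h ->
  unit_potential p q (fun x => Num.min (h x) (h p)).
Proof.
move=> hP; have hqp := unit_potential_le hP.
pose f x := Num.max (h x - h p) 0.
have fh x : Num.min (h x) (h p) = h x - f x.
  by rewrite /f; case: (leP (h x) (h p)) => ?; case: leP; lra.
have f0 x y : w x y * (f x - f y) = 0.
  (* [f] is a nondecreasing 1-Lipschitz function of [h], so on each edge its energy is at most its
     mixed energy with [h]. *)
  have le_term u v : w u v * (f u - f v) ^+ 2 <=
      w u v * (f u - f v) * (h u - h v).
    rewrite -mulrA ler_wpM2l// /f; case: (leP (h u - h p)) => ?;
      case: (leP (h v - h p)) => ?; nra.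
  have ge0_term u v : 0 <= w u v * (f u - f v) * (h u - h v).
    by apply: le_trans (le_term u v); rewrite mulr_ge0// sqr_ge0.
  have := dirichlet_form f h.
  under eq_bigr do rewrite hP.
  have fp : f p = 0 by rewrite /f subrr maxxx.
  have fq : f q = 0 by rewrite /f; apply/max_idPr; rewrite subr_le0.
  rewrite sum_unit_charge fp fq subrr mul0rn => /esym/eqP.
  rewrite psumr_eq0; last by move=> u _; exact: sumr_ge0.
  move=> /allP/(_ x (mem_index_enum _)); rewrite implyTb psumr_eq0//.
  move=> /allP/(_ y (mem_index_enum _)); rewrite implyTb => /eqP E.
  have := le_term x y; rewrite E => le0.
  have : w x y * (f x - f y) ^+ 2 == 0.
    by rewrite eq_le le0 mulr_ge0// sqr_ge0.
  by rewrite mulf_eq0 sqrf_eq0 -mulf_eq0 => /eqP.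
move=> x; rewrite -hP /laplacian; apply: eq_bigr => y _.
rewrite !fh; have := f0 x y; lra.
Qed.

Lemma unit_potentialN p q h : unit_potential p q h ->
  unit_potential q p (fun x => - h x).
Proof.
move=> hP x; rewrite -[RHS]opprB -hP /laplacian -sumrN; apply: eq_bigr => y _; ring.
Qed.

(** Truncate at the potential of [p], reverse the current, truncate at the other pole and reverse
    again. *)
Lemma bounded_unit_potential_exists p q : 0 < w p q ->
  exists h, unit_potential p q h /\ forall x, h q <= h x <= h p.
Proof.
move=> /unit_potential_exists[h0 h0P].
have h0qp := unit_potential_le h0P.
have h1P := unit_potentialN (unit_potential_min h0P).
have h2P := unit_potentialN (unit_potential_min h1P).
eexists; split; first exact: h2P.
move=> x /=; rewrite minxx (min_idPl h0qp) minxx.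
have -> : Num.min (- h0 p) (- h0 q) = - h0 p by apply/min_idPl; rewrite lerN2.
case: (leP (h0 x) (h0 p)) => ?.
  by case: (leP (- h0 x) (- h0 q)) => ?; rewrite !opprK; lra.
by case: (leP (- h0 p) (- h0 q)) => ?; rewrite !opprK; lra.
Qed.

End Electrical.

(** * Potential drops along a matching *)

Section FourTerminals.
Variable R : realFieldType.
Local Notation pos x := (Num.max x 0).

(** [r] and [s] are the extreme potentials, [p_k] and [q_k] those of the rows and columns of three
    further pairs. Once the signs of the six differences across distinct pairs are fixed, everything
    is linear. *)
Lemma three_drops_le (r s p1 p2 p3 q1 q2 q3 : R) :
  s <= p1 <= r -> s <= p2 <= r -> s <= p3 <= r ->
  s <= q1 <= r -> s <= q2 <= r -> s <= q3 <= r ->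
  q1 - p1 <= r - q1 + pos (p2 - q1) + pos (p3 - q1) ->
  q2 - p2 <= r - q2 + pos (p1 - q2) + pos (p3 - q2) ->
  q3 - p3 <= r - q3 + pos (p1 - q3) + pos (p2 - q3) ->
  q1 - p1 <= p1 - s + pos (p1 - q2) + pos (p1 - q3) ->
  q2 - p2 <= p2 - s + pos (p2 - q1) + pos (p2 - q3) ->
  q3 - p3 <= p3 - s + pos (p3 - q1) + pos (p3 - q2) ->
  (q1 - p1) + (q2 - p2) + (q3 - p3) <= r - s.
Proof.
move=> /andP[? ?] /andP[? ?] /andP[? ?] /andP[? ?] /andP[? ?] /andP[? ?].
case: (leP (p1 - q2) 0) => ?; case: (leP (p1 - q3) 0) => ?;
case: (leP (p2 - q1) 0) => ?; case: (leP (p2 - q3) 0) => ?;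
case: (leP (p3 - q1) 0) => ?; case: (leP (p3 - q2) 0) => ?; lra.
Qed.

(* Along a perfect matching of the vertices, [f] and [g] are the potentials of
   the matched pairs of an electrical flow from the upper to the lower vertex of
   the pair [k0]; the two last hypotheses bound the current in the edge of a pair
   by the current that can reach, respectively leave, it. *)
Definition drops_balanced n := forall (f g : 'I_n -> R) (k0 : 'I_n),
  (forall k, g k0 <= f k <= f k0) -> (forall k, g k0 <= g k <= f k0) ->
  (forall k, k != k0 -> g k - f k <= \sum_i pos (f i - g k)) ->
  (forall k, k != k0 -> g k - f k <= \sum_j pos (f k - g j)) ->
  \sum_k g k <= \sum_k f k.

(** Add a pair with both vertices at the lower potential [g k0]: it contributes equally to both
    sums, and only adds nonnegative terms to the bounds on currents. So four pairs are the only case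
    to check. *)
Lemma drops_balancedS n : drops_balanced n.+1 -> drops_balanced n.
Proof.
move=> bal f g k0 fP gP inP outP.
have k0_in : g k0 <= g k0 <= f k0 by have := fP k0; rewrite lexx => /andP[].
pose F k := oapp f (g k0) (unlift (@ord_max n) k).
pose G k := oapp g (g k0) (unlift (@ord_max n) k).
have FE k : F (lift ord_max k) = f k by rewrite /F liftK.
have GE k : G (lift ord_max k) = g k by rewrite /G liftK.
have F0 : F ord_max = g k0 by rewrite /F unlift_none.
have G0 : G ord_max = g k0 by rewrite /G unlift_none.
have sumE (H : 'I_n.+1 -> R) (h : 'I_n -> R) :
    (forall k, H (lift ord_max k) = h k) -> \sum_k H k = H ord_max + \sum_k h k.
  by move=> Hh; rewrite (bigD1_ord ord_max)//=; under eq_bigr do rewrite Hh.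
have pos_ge0 (x : R) : 0 <= pos x by rewrite le_max lexx orbT.
have := bal F G (lift ord_max k0); rewrite FE GE.
rewrite (sumE F f)// (sumE G g)// F0 G0 lerD2l; apply.
- by move=> k; case: (unliftP ord_max k) => [j|] ->; rewrite ?FE ?F0.
- by move=> k; case: (unliftP ord_max k) => [j|] ->; rewrite ?GE ?G0.
- move=> k; case: (unliftP ord_max k) => [j|] ->; rewrite ?FE ?F0 ?GE ?G0.
    rewrite (inj_eq lift_inj) => /inP /le_trans; apply.
    by rewrite (sumE _ (fun i => pos (f i - g j)))=> [|i]; rewrite ?FE// lerDr.
  by move=> _; rewrite subrr sumr_ge0.
- move=> k; case: (unliftP ord_max k) => [j|] ->; rewrite ?FE ?F0 ?GE ?G0.
    rewrite (inj_eq lift_inj) => /outP /le_trans; apply.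
    by rewrite (sumE _ (fun i => pos (f j - g i)))=> [|i]; rewrite ?GE// lerDr.
  by move=> _; rewrite subrr sumr_ge0.
Qed.

Lemma drops_balanced4 : drops_balanced 4.
Proof.
move=> f g k0.
wlog -> : f g k0 / k0 = ord0 => [wlog0|] fP gP inP outP.
  pose t := tperm ord0 k0; have tk0 : t ord0 = k0 by rewrite tpermL.
  have tN k : k != ord0 -> t k != k0.
    by apply: contra => /eqP; rewrite -tk0 => /perm_inj ->.
  rewrite (reindex_inj (@perm_inj _ t)) [leRHS](reindex_inj (@perm_inj _ t)).
  apply: (wlog0 (f \o t) (g \o t) ord0) => //= k; rewrite ?tk0//.
  - by move=> /tN/inP; rewrite (reindex_inj (@perm_inj _ t)).
  - by move=> /tN/outP; rewrite (reindex_inj (@perm_inj _ t)).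
(* The poles carry the extreme potentials, so the positive parts involving them are plain
   differences. *)
have f0 k : pos (f ord0 - g k) = f ord0 - g k.
  by apply/max_idPl; rewrite subr_ge0; case/andP: (gP k).
have g0 k : pos (f k - g ord0) = f k - g ord0.
  by apply/max_idPl; rewrite subr_ge0; case/andP: (fP k).
pose i1 : 'I_4 := lift ord0 ord0.
pose i2 : 'I_4 := lift ord0 (lift ord0 ord0).
pose i3 : 'I_4 := lift ord0 (lift ord0 (lift ord0 ord0)).
have sum4 (h : 'I_4 -> R) : \sum_k h k = h ord0 + h i1 + h i2 + h i3.
  by rewrite !big_ord_recl big_ord0 addr0 !addrA.
have pos_ge0 (x : R) : 0 <= pos x by rewrite le_max lexx orbT.
have self (x y z : R) : 0 <= z -> x - y <= pos (y - x) + z -> x - y <= z.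
  by move=> z0; case: (leP (y - x) 0) => ?; lra.
have in_le k z : k != ord0 -> 0 <= z ->
    \sum_i pos (f i - g k) = pos (f k - g k) + z -> g k - f k <= z.
  by move=> k0' z0 E; apply: self => //; rewrite -E; exact: inP.
have out_le k z : k != ord0 -> 0 <= z ->
    \sum_i pos (f k - g i) = pos (f k - g k) + z -> g k - f k <= z.
  by move=> k0' z0 E; apply: self => //; rewrite -E; exact: outP.
rewrite !sum4.
have gf0 k : 0 <= f ord0 - g k by rewrite -f0.
have fg0 k : 0 <= f k - g ord0 by rewrite -g0.
have : (g i1 - f i1) + (g i2 - f i2) + (g i3 - f i3) <= f ord0 - g ord0.
  apply: three_drops_le;
    [exact: fP|exact: fP|exact: fP|exact: gP|exact: gP|exact: gP|..].
  - by apply: in_le => //;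
      [exact: addr_ge0 (addr_ge0 (gf0 _) _) _|rewrite sum4 f0; ring].
  - by apply: in_le => //;
      [exact: addr_ge0 (addr_ge0 (gf0 _) _) _|rewrite sum4 f0; ring].
  - by apply: in_le => //;
      [exact: addr_ge0 (addr_ge0 (gf0 _) _) _|rewrite sum4 f0; ring].
  - by apply: out_le => //;
      [exact: addr_ge0 (addr_ge0 (fg0 _) _) _|rewrite sum4 g0; ring].
  - by apply: out_le => //;
      [exact: addr_ge0 (addr_ge0 (fg0 _) _) _|rewrite sum4 g0; ring].
  - by apply: out_le => //;
      [exact: addr_ge0 (addr_ge0 (fg0 _) _) _|rewrite sum4 g0; ring].
by lra.
Qed.

Lemma sum_drops_le n : (n <= 4)%N -> drops_balanced n.
Proof.
have b4 := drops_balanced4; have b3 := drops_balancedS b4.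
have b2 := drops_balancedS b3; have b1 := drops_balancedS b2.
by case: n => [|[|[|[|[|//]]]]] _ //; exact: drops_balancedS.
Qed.

End FourTerminals.

(** * Matchings in the support of a doubly stochastic matrix *)

(** A simple path from [b] back to [a] and the edge from [a] to [b] form a cycle; [s] moves its
    vertices one step forward and fixes the others. *)
Lemma edge_cycle_perm (T : finType) (e : rel T) (a b : T) :
  e a b -> connect e b a ->
  exists s : {perm T}, s a = b /\ forall c, s c = c \/ e c (s c).
Proof.
move=> eab /connectP[p0 /shortenP[p pp pu _] Ea].
have cp : path.cycle e (b :: p) by rewrite /= rcons_path pp -Ea.
pose s := perm (can_inj (prev_next pu)); exists s; split=> [|c].
  (* The successor of the last vertex [a] is read past the end of the list, where [nth] returns its
     default [b]. *)
  rewrite permE next_nth Ea mem_last.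
  by rewrite index_last// nth_default.
rewrite permE; have [cin|cNin] := boolP (c \in b :: p).
  by right; exact: next_cycle.
by left; rewrite next_nth (negPf cNin).
Qed.

Section Matching.
Variables (R : realFieldType) (N : nat).

(* The set of vertices reachable from [b] receives all the mass of its rows,
   which already fills its columns. *)
Lemma doubly_stochastic_connect (x : 'I_N -> 'I_N -> R) :
  (forall j, \sum_i x i j = 1) -> (forall i, \sum_j x i j = 1) ->
  (forall i j, 0 <= x i j) ->
  forall a b, 0 < x a b -> connect [rel i j | 0 < x i j] b a.
Proof.
move=> xc xr x0 a b xab; pose A := [pred c | connect [rel i j | 0 < x i j] b c].
apply/negPn/negP => aA.
have bA : b \in A by exact: connect0.
have out i j : i \in A -> j \notin A -> x i j = 0.
  move=> iA jA; apply/eqP; rewrite eq_le x0 andbT leNgt; apply/negP => xij.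
  by move/negP: jA; apply; apply: connect_trans iA _; exact: connect1.
have E1 : \sum_(i in A) \sum_(j in A) x i j = \sum_(i in A) 1.
  apply: eq_bigr => i iA; rewrite -(xr i) [RHS](bigID [in A])/=.
  by rewrite [X in _ + X]big1 ?addr0// => j; exact: out.
have E2 : \sum_(j in A) \sum_(i in A) x i j +
    \sum_(j in A) \sum_(i | i \notin A) x i j = \sum_(j in A) 1.
  rewrite -big_split/=; apply: eq_bigr => j jA.
  by rewrite -(xc j) [RHS](bigID [in A]).
move: E2; rewrite exchange_big/= E1 => /eqP.
rewrite -subr_eq0 addrAC subrr add0r psumr_eq0; last first.
  by move=> j _; exact: sumr_ge0.
move=> /allP/(_ b (mem_index_enum _)); rewrite bA/= psumr_eq0//.
move=> /allP/(_ a (mem_index_enum _)); rewrite aA/= => /eqP x_ab.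
by move: xab; rewrite x_ab ltxx.
Qed.

(* Rotating a matching along the cycle through an edge of the support, read as
   the edge from [k] to the row matched with its column, repairs [k] without
   damaging the other rows. *)
Lemma doubly_stochastic_matching (x : 'I_N -> 'I_N -> R) :
  (forall j, \sum_i x i j = 1) -> (forall i, \sum_j x i j = 1) ->
  (forall i j, 0 <= x i j) ->
  forall i j, 0 < x i j ->
  exists s : {perm 'I_N}, s i = j /\ forall k, 0 < x k (s k).
Proof.
move=> xc xr x0.
have rotate (s : {perm 'I_N}) k j : 0 < x k j -> exists t : {perm 'I_N},
    t k = j /\ forall l, t l = s l \/ 0 < x l (t l).
  move=> xkj; pose y i j := x i (s j).
  have yc l : \sum_i y i l = 1 by exact: xc.
  have yr i : \sum_l y i l = 1.
    by rewrite -(xr i) [RHS](reindex_inj (@perm_inj _ s)).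
  have ykj : 0 < y k (s^-1%g j) by rewrite /y permKV.
  have [|t [tk tP]] := edge_cycle_perm (e := [rel i j | 0 < y i j]) ykj.
    by apply: (doubly_stochastic_connect yc yr) => // l m; exact: x0.
  exists (t * s)%g; rewrite permM tk permKV; split=> // l.
  by rewrite permM; case: (tP l) => [->|]; [left|right].
(* A permutation with the fewest rows matched outside the support has none, since a rotation would
   lower their number. *)
pose bad (s : {perm 'I_N}) := #|[set k | ~~ (0 < x k (s k))]%SET|.
have [s s_good] : exists s : {perm 'I_N}, forall k, 0 < x k (s k).
  have [s smin] : exists s, forall t, (bad s <= bad t)%N.
    have [s _ smin] := @arg_minnP _ (1%g : {perm 'I_N}) xpredT bad isT.
    by exists s => t; exact: smin.
  exists s => k; apply/negPn/negP => kbad.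
  have [j xkj] : exists j, 0 < x k j.
    have [/existsP//|/existsPn xk0] := boolP [exists j, 0 < x k j].
    have := xr k; rewrite big1 => [/eqP|j _]; first by rewrite eq_sym oner_eq0.
    by apply/eqP; rewrite eq_le x0 andbT leNgt xk0.
  have [t [tk tP]] := rotate s k j xkj.
  have := smin t; rewrite leqNgt => /negP; apply; apply: proper_card.
  apply/properP; split.
    apply/fintype.subsetP => l; rewrite !inE; apply: contra => sl.
    by case: (tP l) => [->|].
  by exists k; rewrite !inE ?kbad// tk xkj.
move=> i j xij; have [t [ti tP]] := rotate s i j xij; exists t; split=> // k.
by case: (tP k) => [->|].
Qed.

End Matching.

(* [D] is the point of minimal norm of the affine hull of the face of [x]. For
   the unit current from row [i] to column [j] in the support of [x], the
   elementary matrix at [(i, j)] minus the current has zero marginals, so [D i j]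
   is the pairing of [D] with the current, that is the sum of the row potentials
   minus the sum of the column potentials. *)
Lemma minimal_norm_ge0 (R : realFieldType) (N : nat) (x D : 'I_N -> 'I_N -> R) :
  (N <= 4)%N ->
  (forall b, \sum_a x a b = 1) -> (forall a, \sum_b x a b = 1) ->
  (forall a b, 0 <= x a b) ->
  (forall b, \sum_a D a b = 1) -> (forall a, \sum_b D a b = 1) ->
  (forall a b, x a b = 0 -> D a b = 0) ->
  (forall M : 'I_N -> 'I_N -> R, (forall a b, x a b = 0 -> M a b = 0) ->
     (forall b, \sum_a M a b = 0) -> (forall a, \sum_b M a b = 0) ->
     \sum_a \sum_b D a b * M a b = 0) ->
  forall i j, 0 <= D i j.
Proof.
move=> N4 xc xr x0 Dc Dr Dx Dorth i j.
have [xij0|xij_neq0] := eqVneq (x i j) 0; first by rewrite Dx.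
have xij : 0 < x i j by rewrite lt_def xij_neq0 x0.
have [s [si sP]] := doubly_stochastic_matching xc xr x0 xij.
pose e a b : R := (x a b != 0)%:R.
have e_ge0 a b : 0 <= e a b by rewrite ler0n.
have e_s k : e k (s k) = 1 by rewrite /e gt_eqF.
(* The bipartite graph of the support: rows come first, columns last, and every edge has conductance
   1. *)
pose w : 'M[R]_(N + N) :=
  block_mx 0 (\matrix_(a, b) e a b) (\matrix_(b, a) e a b) 0.
have w_ll a b : w (lshift N a) (lshift N b) = 0 by rewrite block_mxEul mxE.
have w_lr a b : w (lshift N a) (rshift N b) = e a b by rewrite block_mxEur mxE.
have w_rl a b : w (rshift N b) (lshift N a) = e a b by rewrite block_mxEdl mxE.
have w_rr a b : w (rshift N a) (rshift N b) = 0 by rewrite block_mxEdr mxE.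
have w_sym u v : w u v = w v u.
  by case: (split_ordP u) => ? ->; case: (split_ordP v) => ? ->;
    rewrite ?w_ll ?w_lr ?w_rl ?w_rr.
have w_ge0 u v : 0 <= w u v.
  by case: (split_ordP u) => ? ->; case: (split_ordP v) => ? ->;
    rewrite ?w_ll ?w_lr ?w_rl ?w_rr.
have w_ij : 0 < w (lshift N i) (rshift N j).
  by rewrite w_lr /e xij_neq0 ltr01.
have [h [hP h_in]] := bounded_unit_potential_exists w_sym w_ge0 w_ij.
pose f a := h (lshift N a); pose g b := h (rshift N b).
have row_law a : \sum_b e a b * (f a - g b) = (a == i)%:R.
  have := hP (lshift N a); rewrite /laplacian big_split_ord/=.
  rewrite big1 ?add0r => [|b _]; last by rewrite w_ll mul0r.
  rewrite eq_lrshift subr0 eq_lshift => <-.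
  by apply: eq_bigr => b _; rewrite w_lr.
have col_law b : \sum_a e a b * (f a - g b) = (b == j)%:R.
  have := hP (rshift N b); rewrite /laplacian big_split_ord/=.
  rewrite addrC big1 ?add0r => [|a _]; last by rewrite w_rr mul0r.
  rewrite eq_rlshift sub0r eq_rshift => /(congr1 -%R); rewrite opprK => <-.
  by rewrite -sumrN; apply: eq_bigr => a _; rewrite w_rl/= -mulrN opprB.
have DE : D i j = \sum_a f a - \sum_b g b.
  pose M a b := (a == i)%:R * (b == j)%:R - e a b * (f a - g b).
  have : \sum_a \sum_b D a b * M a b = 0.
    apply: Dorth => [a b xab0|b|a].
    - rewrite /M /e xab0 eqxx mul0r subr0.
      have [ai|] := eqVneq a i; last by rewrite mul0r.
      have [bj|] := eqVneq b j; last by rewrite mulr0.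
      by rewrite ai bj in xab0; rewrite xab0 eqxx in xij_neq0.
    - rewrite sumrB col_law -mulr_suml (bigD1 i)//= eqxx big1 ?addr0 ?mul1r ?subrr//.
      by move=> a /negPf->.
    - rewrite sumrB row_law -mulr_sumr (bigD1 j)//= eqxx big1 ?addr0 ?mulr1 ?subrr//.
      by move=> b /negPf->.
  (* As [D] vanishes off the support, the factor [e] disappears; then the unit marginals of [D]
     reduce the pairing to sums of potentials. *)
  have -> : \sum_a \sum_b D a b * M a b =
      D i j - (\sum_a \sum_b D a b * f a - \sum_a \sum_b D a b * g b).
    have -> : D i j = \sum_a \sum_b D a b * ((a == i)%:R * (b == j)%:R).
      rewrite (bigD1 i)//= [X in _ + X]big1 ?addr0 => [|a /negPf ai]; last first.
        by rewrite big1// => b _; rewrite ai mul0r mulr0.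
      rewrite (bigD1 j)//= [X in _ + X]big1 ?addr0 => [|b /negPf bj]; last first.
        by rewrite bj !mulr0.
      by rewrite !eqxx !mulr1.
    rewrite -!sumrB; apply: eq_bigr => a _; rewrite -!sumrB.
    apply: eq_bigr => b _; rewrite /M /e.
    by have [/Dx->|_] := eqVneq (x a b) 0 => /=; ring.
  move/eqP; rewrite subr_eq0 => /eqP ->; congr (_ - _).
    by apply: eq_bigr => a _; rewrite -mulr_suml Dr mul1r.
  by rewrite exchange_big/=; apply: eq_bigr => a _; rewrite -mulr_suml Dc mul1r.
rewrite DE subr_ge0 (reindex_inj (@perm_inj _ s)).
have e_pos a b y : e a b * y <= Num.max y 0.
  by rewrite /e; case: (x a b != 0); rewrite ?mul1r ?mul0r le_max lexx ?orbT.
have pos_ge0 (y : R) : 0 <= Num.max y 0 by rewrite le_max lexx orbT.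
apply: (sum_drops_le N4 (f := f) (g := g \o s) (k0 := i)) => k /=; rewrite ?si//.
- by rewrite h_in.
- by rewrite h_in.
(* No external current reaches the column of a pair other than [i], so the current in the matched
   edge is balanced by the other edges there, each bounded by its positive part. The last case does
   the same at the row. *)
- move=> ki; have := col_law (s k).
  rewrite -si (inj_eq (@perm_inj _ s)) (negPf ki) (bigD1 k)//= e_s mul1r.
  move=> /eqP; rewrite addr_eq0 => /eqP/(congr1 -%R); rewrite opprB opprK => ->.
  rewrite [leRHS](bigD1 k)//=; apply: ler_wpDl => //.
  by apply: ler_sum => a _.
- move=> ki; have := row_law k.
  rewrite (negPf ki) (bigD1 (s k))//= e_s mul1r.
  move=> /eqP; rewrite addr_eq0 => /eqP/(congr1 -%R); rewrite opprB opprK => ->.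
  have <- : \sum_b Num.max (f k - g b) 0 = \sum_b Num.max (f k - g (s b)) 0.
    by rewrite (reindex_inj (@perm_inj _ s)).
  rewrite [leRHS](bigD1 (s k))//=; apply: ler_wpDl => //.
  by apply: ler_sum => a _.
Qed.

(** * Nearest points *)

Lemma cvg_sumr (R : realType) (I : finType) T (F : set_system T)
    {FF : Filter F} (f : I -> T -> R) (a : I -> R) :
  (forall i, f i t @[t --> F] --> a i) ->
  (\sum_i f i t) @[t --> F] --> \sum_i a i.
Proof.
move=> fa.
exact: (@cvg_big R I +%R 0 xpredT (@add_continuous R) T F _ f a FF).
Qed.

Section Frobenius.
Variables (R : realType) (m n : nat).
Implicit Types x y z : 'M[R]_(m, n).

Lemma frob_innerC x y : frob_inner x y = frob_inner y x.
Proof. by apply: eq_bigr => i _; apply: eq_bigr => j _; rewrite mulrC. Qed.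

Lemma frob_innerDl x y z :
  frob_inner (x + y) z = frob_inner x z + frob_inner y z.
Proof.
rewrite -big_split/=; apply: eq_bigr => i _; rewrite -big_split/=.
by apply: eq_bigr => j _; rewrite mxE mulrDl.
Qed.

Lemma frob_innerZl a x y : frob_inner (a *: x) y = a * frob_inner x y.
Proof.
rewrite mulr_sumr; apply: eq_bigr => i _; rewrite mulr_sumr.
by apply: eq_bigr => j _; rewrite mxE mulrA.
Qed.

Lemma frob_innerNl x y : frob_inner (- x) y = - frob_inner x y.
Proof. by rewrite -scaleN1r frob_innerZl mulN1r. Qed.

Lemma frob_innerDr x y z :
  frob_inner x (y + z) = frob_inner x y + frob_inner x z.
Proof. by rewrite ![frob_inner x _]frob_innerC frob_innerDl. Qed.

Lemma frob_innerZr a x y : frob_inner x (a *: y) = a * frob_inner x y.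
Proof. by rewrite ![frob_inner x _]frob_innerC frob_innerZl. Qed.

Lemma frob_innerNr x y : frob_inner x (- y) = - frob_inner x y.
Proof. by rewrite ![frob_inner x _]frob_innerC frob_innerNl. Qed.

Definition frob_innerE := (frob_innerDl, frob_innerDr, frob_innerNl,
  frob_innerNr, frob_innerZl, frob_innerZr).

Lemma sqr_entry_le x i j : x i j ^+ 2 <= frob_inner x x.
Proof.
rewrite /frob_inner (bigD1 i)//= (bigD1 j)//= -expr2 -addrA lerDl addr_ge0//.
  by apply: sumr_ge0 => k _; rewrite -expr2 sqr_ge0.
by apply: sumr_ge0 => k _; apply: sumr_ge0 => l _; rewrite -expr2 sqr_ge0.
Qed.

Lemma frob_inner_ge0 x : 0 <= frob_inner x x.
Proof.
by apply: sumr_ge0 => k _; apply: sumr_ge0 => l _; rewrite -expr2 sqr_ge0.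
Qed.

Lemma frob_inner_le0 x : frob_inner x x <= 0 -> x = 0.
Proof.
move=> x0; apply/matrixP => i j; rewrite mxE; apply/eqP.
by rewrite -sqrf_eq0 eq_le sqr_ge0 andbT (le_trans (sqr_entry_le x i j)).
Qed.

Lemma frob_norm_le x y :
  (frob_norm x <= frob_norm y) = (frob_inner x x <= frob_inner y y).
Proof. by rewrite /frob_norm ler_sqrt// frob_inner_ge0. Qed.

Lemma continuous_frob_inner z :
  continuous (fun x : 'M[R]_(m, n) => frob_inner (x - z) (x - z)).
Proof.
move=> x; rewrite /frob_inner.
have Fx : Filter (nbhs x) by exact: nbhs_filter.
apply: (cvg_sumr (FF := Fx)) => i; apply: (cvg_sumr (FF := Fx)) => j.
have xz : (x' - z) i j @[x' --> x] --> (x - z) i j.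
  under eq_fun do rewrite !mxE; rewrite !mxE.
  by apply: cvgB; [exact: coord_continuous|exact: cvg_cst].
exact: cvgM.
Qed.

End Frobenius.

Section NearestPoint.
Variables (R : realType) (m n : nat) (P : set 'M[R]_(m, n)).
Implicit Types x y z c : 'M[R]_(m, n).

Lemma nearest_point_exists z : compact P -> P !=set0 ->
  exists x, is_nearest_point P z x.
Proof.
move=> cP P0.
have [|x xP xmin] :=
    @compact_EVT_min _ R (fun x => frob_inner (x - z) (x - z)) P P0 cP.
  exact: continuous_subspaceT (@continuous_frob_inner R m n z).
exists x; split; first by rewrite -inE.
by move=> y yP; rewrite frob_norm_le; apply: xmin; rewrite inE.
Qed.

Lemma variational_nearest z x : P x ->
  (forall y, P y -> 0 <= frob_inner (x - z) (y - x)) -> is_nearest_point P z x.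
Proof.
move=> Px vi; split=> // y Py; rewrite frob_norm_le.
have -> : y - z = (y - x) + (x - z) by rewrite addrA subrK.
have := vi y Py; have := frob_inner_ge0 (y - x).
move: (y - x) (x - z) => u v.
rewrite !frob_innerE [frob_inner u v]frob_innerC; lra.
Qed.

Hypothesis convP : forall x y t, P x -> P y -> 0 <= t -> t <= 1 ->
  P (x + t *: (y - x)).

Lemma nearest_variational z x : is_nearest_point P z x ->
  forall y, P y -> 0 <= frob_inner (x - z) (y - x).
Proof.
move=> [Px xmin] y Py; rewrite leNgt; apply/negP.
set a := frob_inner _ _; pose b := frob_inner (y - x) (y - x) => a0.
have b0 : 0 <= b := frob_inner_ge0 _.
have ba : 0 < b - a by lra.
(* For this step, [t * b + 2 * a] equals [(1 + t) * a], which is negative; times [t], it is the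
   change in squared distance to [z]. *)
pose t := - a / (b - a).
have t0 : 0 < t by rewrite divr_gt0// oppr_gt0.
have t1 : t <= 1 by rewrite ler_pdivrMr// mul1r; lra.
have := xmin _ (convP Px Py (ltW t0) t1); rewrite frob_norm_le.
have -> : x + t *: (y - x) - z = (x - z) + t *: (y - x) by rewrite addrAC.
rewrite (frob_innerDl (x - z)) 2!(frob_innerDr _ (x - z)).
rewrite !frob_innerZl !frob_innerZr.
rewrite [frob_inner (y - x) (x - z)]frob_innerC -/a -/b.
have tba : t * (b - a) = - a by rewrite /t divfK// gt_eqF.
have : t * (t * b + a * 2) < 0.
  rewrite pmulr_rlt0//.
  have -> : t * b = - a + t * a by rewrite -tba; ring.
  have : t * a < 0 by rewrite pmulr_rlt0.
  lra.
lra.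
Qed.

Lemma nearest_unique z x x' :
  is_nearest_point P z x -> is_nearest_point P z x' -> x = x'.
Proof.
move=> xz x'z; apply/eqP; rewrite -subr_eq0; apply/eqP/frob_inner_le0.
have := nearest_variational xz x'z.1; have := nearest_variational x'z xz.1.
rewrite !frob_innerE; lra.
Qed.

Lemma projE z x : is_nearest_point P z x -> Defs.proj P z = x.
Proof.
move=> xz; apply: (@nearest_unique z) => //.
by apply: (@xgetPex _ point [set y | is_nearest_point P z y]); exists x.
Qed.

Lemma proj_nearest z : (exists x, is_nearest_point P z x) ->
  is_nearest_point P z (Defs.proj P z).
Proof. by move=> [x xz]; rewrite (projE xz). Qed.

(** The two variational inequalities add up to [|d|^2 <= <e, d>]; expanding [|e - d|^2 >= 0] then
    replaces Cauchy-Schwarz. *)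
Lemma nearest_lipschitz z z' x x' :
  is_nearest_point P z x -> is_nearest_point P z' x' ->
  frob_inner (x - x') (x - x') <= frob_inner (z - z') (z - z').
Proof.
move=> xz x'z'.
have := nearest_variational xz x'z'.1; have := nearest_variational x'z' xz.1.
rewrite -[x' - x]opprB; set d := x - x'; set e := z - z'.
rewrite frob_innerNr => vi' vi.
have ed : frob_inner d d <= frob_inner e d.
  rewrite {1}/d /e !frob_innerDl !frob_innerNl.
  move: vi vi'; rewrite !frob_innerDl !frob_innerNl; lra.
clearbody d e; have := frob_inner_ge0 (e - d).
rewrite !frob_innerDl !frob_innerDr !frob_innerNl !frob_innerNr.
rewrite [frob_inner d e]frob_innerC; lra.
Qed.

(** The variational inequalities add up to [<c, y - x> <= 0], so the one for [s] gives
    [<x, y - x> >= 0]. Conclude with [|y|^2 - |x|^2 = |y - x|^2 + 2 <x, y - x>]. *)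
Lemma nearest_energy c s t x y : 0 <= s -> s <= t ->
  is_nearest_point P (- (s *: c)) x -> is_nearest_point P (- (t *: c)) y ->
  frob_inner (y - x) (y - x) <= frob_inner y y - frob_inner x x.
Proof.
move=> s0 st xs yt; have [Est|s_neq_t] := eqVneq s t.
  rewrite Est in xs; rewrite (nearest_unique xs yt) !subrr.
  by rewrite -(scale0r c) frob_innerZl mul0r.
have := nearest_variational xs yt.1; have := nearest_variational yt xs.1.
have := frob_inner_ge0 (y - x); rewrite !frob_innerE [frob_inner y x]frob_innerC.
set xx := frob_inner x x; set yy := frob_inner y y; set xy := frob_inner x y.
set cx := frob_inner c x; set cy := frob_inner c y => yx0 vi_t vi_s.
have ts : 0 < t - s by rewrite subr_gt0 lt_def eq_sym s_neq_t.
have : (t - s) * (cy - cx) <= 0 by lra.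
rewrite pmulr_rle0// => g; have := mulr_ge0_le0 s0 g; lra.
Qed.

(* The energies along the ray are nondecreasing and bounded, hence Cauchy. *)
Lemma nearest_ray_is_cvg c K (ray : R -> 'M[R]_(m, n)) :
  (forall t, is_nearest_point P (- (t *: c)) (ray t)) ->
  (forall x, P x -> frob_inner x x <= K) -> cvg (ray t @[t --> +oo]).
Proof.
move=> rayP PK; apply/cauchy_cvgP/cauchy_exP => e e0.
pose E : set R := [set frob_inner (ray t) (ray t) | t in `[0, +oo[].
have supE : has_sup E.
  split; first by exists (frob_inner (ray 0) (ray 0)); exists 0 => //=;
    rewrite in_itv/= lexx.
  by exists K => _ [t _ <-]; exact: PK (rayP _).1.
have e2 : 0 < e ^+ 2 by rewrite exprn_gt0.
(* After a time whose energy is within [e ^+ 2] of the supremum, the ray moves by less than [e]. *)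
have [y [t0 /=]] := sup_adherent e2 supE.
rewrite in_itv/= andbT => t0_ge0 yE; rewrite -{y}yE => t0E.
exists (ray t0).
suff : \forall t \near +oo, ball (ray t0) e (ray t) by [].
near=> t.
have t0t : t0 <= t by near: t; apply: nbhs_pinfty_ge; exact: num_real.
split=> // i j; rewrite /ball/= -ltr_sqr ?nnegrE ?normr_ge0 ?(ltW e0)//.
rewrite real_normK ?num_real//.
apply: (@le_lt_trans _ _ (frob_inner (ray t - ray t0) (ray t - ray t0))).
  by have := sqr_entry_le (ray t - ray t0) i j; rewrite !mxE -sqrrN opprB.
apply: le_lt_trans (nearest_energy t0_ge0 t0t (rayP t0) (rayP t)) _.
have : frob_inner (ray t) (ray t) <= sup E.
  apply: sup_upper_bound => //; exists t => //=.
  by rewrite in_itv/= andbT (le_trans t0_ge0).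
lra.
Unshelve. all: by end_near. Qed.

End NearestPoint.

(** * The Birkhoff polytope *)

Section Birkhoff.
Variables (R : realType) (N : nat).
Implicit Types x y c M : 'M[R]_N.
Local Notation Pi := (@birkhoff R N).

Lemma birkhoff_convex x y t : Pi x -> Pi y -> 0 <= t -> t <= 1 ->
  Pi (x + t *: (y - x)).
Proof.
move=> [xc xr x0] [yc yr y0] t0 t1; split=> [j|i|i j].
- rewrite -[RHS](xc j); under eq_bigr do rewrite !mxE.
  by rewrite big_split/= -mulr_sumr sumrB xc yc subrr mulr0 addr0.
- rewrite -[RHS](xr i); under eq_bigr do rewrite !mxE.
  by rewrite big_split/= -mulr_sumr sumrB xr yr subrr mulr0 addr0.
- have -> : (x + t *: (y - x)) i j = (1 - t) * x i j + t * y i j.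
    by rewrite !mxE; ring.
  by rewrite addr_ge0// mulr_ge0// subr_ge0.
Qed.

Lemma birkhoff1 : Pi 1%:M.
Proof.
split=> [j|i|i j].
- by rewrite (bigD1 j)//= mxE eqxx big1 ?addr0// => i /negPf; rewrite mxE => ->.
- by rewrite (bigD1 i)//= mxE eqxx big1 ?addr0// => j; rewrite mxE eq_sym => /negPf ->.
- by rewrite mxE ler0n.
Qed.

Lemma birkhoff_le1 x i j : Pi x -> x i j <= 1.
Proof.
by move=> [_ xr x0]; rewrite -(xr i) (bigD1 j)//= lerDl sumr_ge0.
Qed.

Lemma birkhoff_energy x : Pi x -> frob_inner x x <= \sum_(i < N) \sum_(j < N) 1.
Proof.
move=> Px; have [_ _ x0] := Px.
by apply: ler_sum => i _; apply: ler_sum => j _; rewrite mulr_ile1// birkhoff_le1.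
Qed.

Lemma closed_birkhoff : closed Pi.
Proof.
have col_closed : closed [set x : 'M[R]_N | forall j, \sum_i x i j = 1].
  rewrite [X in closed X](_ : _ =
      \bigcap_(j in [set: 'I_N]) ((fun x => \sum_i x i j) @^-1` [set 1])).
    apply: closed_bigI => j _; apply: preimage_closed; last exact: closed_eq.
    move=> x _; have Fx : Filter (nbhs x) by exact: nbhs_filter.
    by apply: (cvg_sumr (FF := Fx)) => i; exact: coord_continuous.
  by apply/seteqP; split => x /= xP j; [move=> _|]; exact: xP.
have row_closed : closed [set x : 'M[R]_N | forall i, \sum_j x i j = 1].
  rewrite [X in closed X](_ : _ =
      \bigcap_(i in [set: 'I_N]) ((fun x => \sum_j x i j) @^-1` [set 1])).
    apply: closed_bigI => i _; apply: preimage_closed; last exact: closed_eq.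
    move=> x _; have Fx : Filter (nbhs x) by exact: nbhs_filter.
    by apply: (cvg_sumr (FF := Fx)) => j; exact: coord_continuous.
  by apply/seteqP; split => x /= xP j; [move=> _|]; exact: xP.
have ge0_closed : closed [set x : 'M[R]_N | forall i j, 0 <= x i j].
  rewrite [X in closed X](_ : _ = \bigcap_(p in [set: 'I_N * 'I_N])
      ((fun x => x p.1 p.2) @^-1` [set y | 0 <= y])).
    apply: closed_bigI => p _; apply: preimage_closed; last exact: closed_ge.
    by move=> x _; exact: coord_continuous.
  by apply/seteqP; split => [x xP p _|x xP i j]; [exact: xP|exact: (xP (i, j))].
rewrite [X in closed X](_ : _ = [set x : 'M[R]_N | forall j, \sum_i x i j = 1] `&`
    [set x : 'M[R]_N | forall i, \sum_j x i j = 1] `&`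
    [set x : 'M[R]_N | forall i j, 0 <= x i j]); last first.
  by apply/seteqP; split => x /= [] // [].
by apply: closedI => //; exact: closedI.
Qed.

(** The polytope is a closed subset of the image under [vec_mx] of a cube of row vectors. *)
Lemma compact_birkhoff : compact Pi.
Proof.
pose C := [set v : 'rV[R]_(N * N) | forall k, v ord0 k \in `[0, 1]].
have cC : compact C.
  by apply: (@rV_compact _ _ (fun=> `[0 : R, 1]%classic)) => _; exact: segment_compact.
apply: (subclosed_compact closed_birkhoff (B := vec_mx @` C)).
  apply: continuous_compact => //; apply: continuous_subspaceT => v.
  have Fv : Filter (nbhs v) by exact: nbhs_filter.
  apply/(@cvg_ballP _ _ _ _ Fv) => e e0; apply/nbhs_ballP; exists e => // u [_ vu].
  split=> // i j; rewrite -[X in ball X](mxvecE (vec_mx v)).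
  by rewrite -(mxvecE (vec_mx u)) !vec_mxK.
move=> x Px; exists (mxvec x); last exact: mxvecK.
move=> k /=; have [_ _ x0] := Px; case/mxvec_indexP: k => i j.
by rewrite mxvecE in_itv/= x0 birkhoff_le1.
Qed.

Lemma birkhoff_nearest z : exists x, is_nearest_point Pi z x.
Proof.
by apply: nearest_point_exists compact_birkhoff _; exists 1%:M; exact: birkhoff1.
Qed.

Definition zero_marginals M :=
  (forall j, \sum_i M i j = 0) /\ (forall i, \sum_j M i j = 0).

Lemma birkhoff_sub x y : Pi x -> Pi y -> zero_marginals (x - y).
Proof.
move=> [xc xr _] [yc yr _]; split=> [j|i]; under eq_bigr do rewrite !mxE.
  by rewrite sumrB xc yc subrr.
by rewrite sumrB xr yr subrr.
Qed.

Lemma birkhoff_perturb x M : Pi x -> zero_marginals M ->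
  (forall i j, x i j = 0 -> M i j = 0) ->
  exists2 e, 0 < e & Pi (x + e *: M).
Proof.
move=> [xc xr x0] [Mc Mr] xM.
have denom i j : 0 < 1 + `|M i j| by rewrite ltr_pwDl.
(* The smallest ratio over the support; the summand 1 keeps the denominators positive. *)
pose e := \big[Num.min/1]_(p : 'I_N * 'I_N | x p.1 p.2 != 0)
  (x p.1 p.2 / (1 + `|M p.1 p.2|)).
have e0 : 0 < e.
  apply: lt_bigmin => // p xp; rewrite divr_gt0//.
  by rewrite lt_def xp x0.
exists e => //; split=> [j|i|i j].
- under eq_bigr do rewrite !mxE.
  by rewrite big_split/= -mulr_sumr xc Mc mulr0 addr0.
- under eq_bigr do rewrite !mxE.
  by rewrite big_split/= -mulr_sumr xr Mr mulr0 addr0.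
- rewrite !mxE; have [xij0|xij] := eqVneq (x i j) 0.
    by rewrite xij0 xM// mulr0 addr0.
  have : e <= x i j / (1 + `|M i j|) by apply: (bigmin_inf (i, j)).
  rewrite ler_pdivlMr// => eM.
  have : - (e * M i j) <= e * `|M i j| by rewrite -mulrN ler_pM2l// -normrN ler_norm.
  lra.
Qed.

(** The segment from [y] to [x] can be prolonged beyond [x] to some [z] in the polytope, so the face
    contains an interior point of the segment from [z] to [y], hence [y]. *)
Lemma face_absorbs F x y : is_face Pi F -> F x -> Pi y ->
  (forall i j, x i j = 0 -> y i j = 0) -> F y.
Proof.
move=> [_ FPi Fseg] Fx Py xy; have Px := FPi x Fx.
have [i j xij0|e e0 Pz] := birkhoff_perturb Px (birkhoff_sub Px Py).
  by rewrite !mxE xij0 xy// subrr.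
set z := _ + _ in Pz.
apply: (Fseg z y) => [w [t]|  |].
- rewrite /= in_itv/= => /andP[t0 t1] <-.
  rewrite (_ : _ + _ = z + t *: (y - z)).
    by apply: birkhoff_convex => //; exact: ltW.
  by rewrite scalerBl scale1r scalerBr addrA addrAC.
- have d0 : 0 < 1 + e by rewrite addr_gt0.
  exists x; split=> //; exists (e / (1 + e)).
    by rewrite /= in_itv/= divr_gt0//= ltr_pdivrMr// mul1r ltrDr.
  apply/matrixP => i j; rewrite !mxE; field; exact: lt0r_neq0.
- exists 1; rewrite /= ?in_itv/= ?ler01 ?lexx//.
  by rewrite subrr scale0r add0r scale1r.
Qed.

End Birkhoff.

(** * Projections along a ray *)

Section BirkhoffRay.
Variables (R : realType) (N : nat) (c : 'M[R]_N) (ray : R -> 'M[R]_N).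
Local Notation Pi := (@birkhoff R N).
Hypothesis ray_nearest : forall t, is_nearest_point Pi (- (t *: c)) (ray t).

Lemma ray_birkhoff t : Pi (ray t).
Proof. exact: (ray_nearest t).1. Qed.

(** Both [M] and [- M] are feasible directions at [ray t], so the variational inequality is an
    equality. *)
Lemma ray_orthogonal t (M : 'M[R]_N) : zero_marginals M ->
  (forall i j, ray t i j = 0 -> M i j = 0) -> frob_inner (ray t + t *: c) M = 0.
Proof.
move=> M0 Mray.
have ge0 M' : zero_marginals M' -> (forall i j, ray t i j = 0 -> M' i j = 0) ->
    0 <= frob_inner (ray t + t *: c) M'.
  move=> M'0 M'ray.
  have [e e0 /(nearest_variational (@birkhoff_convex R N) (ray_nearest t))] :=
    birkhoff_perturb (ray_birkhoff t) M'0 M'ray.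
  by rewrite opprK addrAC subrr add0r frob_innerZr pmulr_rge0.
apply/eqP; rewrite eq_le ge0// andbT -oppr_ge0 -frob_innerNr ge0//.
  by split=> k; under eq_bigr do rewrite mxE; rewrite sumrN ?M0.1 ?M0.2 oppr0.
by move=> i j /Mray; rewrite mxE => ->; rewrite oppr0.
Qed.

(* While the support is constant, [ray t / t] is affine in [1 / t], and its slope
   is the point of minimal norm of the affine hull of the face. *)
Lemma ray_same_support s t : (N <= 4)%N -> 0 < s -> s < t ->
  (forall i j, (ray s i j == 0) = (ray t i j == 0)) ->
  forall i j, s * ray t i j <= t * ray s i j.
Proof.
move=> N4 s0 st supp i j.
have ts : 0 < t - s by rewrite subr_gt0.
(* The slope of [ray u / u] as a function of [1 / u], between the times [s] and [t]. *)
pose D a b := (t * ray s a b - s * ray t a b) / (t - s).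
suff : 0 <= D i j by rewrite /D pmulr_lge0 ?invr_gt0// subr_ge0.
have [sc sr s_ge0] := ray_birkhoff s; have [tc tr t_ge0] := ray_birkhoff t.
apply: (minimal_norm_ge0 N4 sc sr s_ge0) => [b|a|a b ray0|M Mray Mc Mr].
- rewrite -mulr_suml sumrB -!mulr_sumr sc tc !mulr1 divff//; exact: lt0r_neq0.
- rewrite -mulr_suml sumrB -!mulr_sumr sr tr !mulr1 divff//; exact: lt0r_neq0.
- rewrite /D ray0; move/eqP: ray0; rewrite supp => /eqP ->.
  by rewrite !mulr0 subrr mul0r.
- pose M' : 'M[R]_N := \matrix_(a, b) M a b.
  have M'0 : zero_marginals M'.
    by split=> k; [rewrite -[RHS](Mc k)|rewrite -[RHS](Mr k)];
      apply: eq_bigr => l _; rewrite mxE.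
  have Os : frob_inner (ray s + s *: c) M' = 0.
    by apply: ray_orthogonal => // a b /Mray; rewrite mxE.
  have Ot : frob_inner (ray t + t *: c) M' = 0.
    apply: ray_orthogonal => // a b /eqP; rewrite -supp => /eqP/Mray.
    by rewrite mxE.
  have -> : \sum_a \sum_b D a b * M a b =
      frob_inner ((t - s)^-1 *: (t *: ray s - s *: ray t)) M'.
    by apply: eq_bigr => a _; apply: eq_bigr => b _; rewrite !mxE /D [_ / _]mulrC.
  move: Os Ot; rewrite !frob_innerE => Os Ot.
  (* In [t *: ray s - s *: ray t] the contributions of [c] cancel. *)
  have -> : frob_inner (ray s) M' = - (s * frob_inner c M') by lra.
  have -> : frob_inner (ray t) M' = - (t * frob_inner c M') by lra.
  by ring.
Qed.

(** The constant [1 + |c|^2] dominates [|c|] and avoids a square root. *)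
Lemma ray_lipschitz s t i j :
  `|ray t i j - ray s i j| <= `|t - s| * (1 + frob_inner c c).
Proof.
have c0 := frob_inner_ge0 c.
rewrite -ler_sqr ?nnegrE ?mulr_ge0 ?addr_ge0// exprMn !real_normK ?num_real//.
have := nearest_lipschitz (@birkhoff_convex R N) (ray_nearest t) (ray_nearest s).
have -> : - (t *: c) - - (s *: c) = (s - t) *: c by rewrite opprK scalerBl addrC.
have := sqr_entry_le (ray t - ray s) i j; rewrite !mxE => /le_trans /[apply].
move/le_trans; apply; rewrite frob_innerZl frob_innerZr mulrA.
rewrite (_ : (s - t) * (s - t) = (t - s) ^+ 2); last by ring.
rewrite ler_wpM2l ?sqr_ge0//; nra.
Qed.

(** At time 0 the projection of the origin is the uniform matrix, as constant matrices are
    orthogonal to differences of doubly stochastic ones. *)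
Lemma ray0_gt0 i j : 0 < ray 0 i j.
Proof.
have N0 : 0 < N%:R :> R by rewrite ltr0n (leq_ltn_trans _ (ltn_ord i)).
have -> : ray 0 = const_mx N%:R^-1.
  apply: (nearest_unique (@birkhoff_convex R N) (ray_nearest 0)).
  apply: variational_nearest.
    split=> [k|k|k l]; last by rewrite mxE invr_ge0 ltW.
      under eq_bigr do rewrite mxE.
      by rewrite sumr_const card_ord -[RHS](@mulfV _ N%:R) ?gt_eqF// mulr_natl.
    under eq_bigr do rewrite mxE.
    by rewrite sumr_const card_ord -[RHS](@mulfV _ N%:R) ?gt_eqF// mulr_natl.
  move=> y [yc yr y0]; rewrite scale0r oppr0 subr0.
  suff -> : frob_inner (const_mx N%:R^-1) (y - const_mx N%:R^-1) = 0 by [].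
  rewrite /frob_inner big1// => k _; under eq_bigr do rewrite !mxE.
  rewrite -mulr_sumr sumrB yr sumr_const card_ord.
  rewrite -[X in X - _](@mulfV _ N%:R) ?gt_eqF//.
  by rewrite mulr_natl subrr mulr0.
by rewrite mxE invr_gt0.
Qed.

(** Pigeonhole: if each of the finitely many zero patterns were absent on some interval to the right
    of [t0], the shortest of these intervals would contain a time with no pattern. *)
Lemma ray_support_frequent t0 : exists S : {set 'I_N * 'I_N},
  forall u, t0 < u -> exists t, [/\ t0 < t, t < u &
    [set p | ray t p.1 p.2 == 0]%SET = S].
Proof.
apply: contrapT => /forallNP noS.
have /choice[u uP] : forall S : {set 'I_N * 'I_N}, exists u, t0 < u /\
    forall t, t0 < t -> t < u -> [set p | ray t p.1 p.2 == 0]%SET <> S.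
  move=> S; have /existsNP[u /not_implyP[t0u noT]] := noS S.
  by exists u; split=> // t t0t tu tS; apply: noT; exists t.
pose v := \big[Num.min/t0 + 1]_S u S.
have t0v : t0 < v by apply: lt_bigmin => [|S _]; [rewrite ltrDl|exact: (uP S).1].
pose t := (t0 + v) / 2.
have t0t : t0 < t by rewrite midf_lt.
have tv : t < v by rewrite midf_lt.
apply: (uP [set p | ray t p.1 p.2 == 0]%SET).2 t0t _ erefl.
by apply: (lt_le_trans tv); exact: bigmin_le.
Qed.

Lemma ray_support_decreasing s t i j : (N <= 4)%N -> 0 <= s -> s <= t ->
  ray s i j = 0 -> ray t i j = 0.
Proof.
move=> N4 s0 st rs; apply/eqP; apply: contraT => rt.
have ray_ge0 u a b : 0 <= ray u a b by have [] := ray_birkhoff u.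
pose L := 1 + frob_inner c c.
have L0 : 0 < L by rewrite ltr_pwDl// frob_inner_ge0.
pose Z := [set u | [/\ s <= u, u <= t & ray u i j = 0]].
have supZ : has_sup Z.
  by split; [exists s; split|exists t => u []].
(* The last zero of the entry before [t]; the Lipschitz bound shows that it is attained. *)
pose t0 := sup Z.
have st0 : s <= t0 by apply: sup_upper_bound.
have t0t : t0 <= t by apply: ge_sup; [exists s; split|move=> u []].
have rt0 : ray t0 i j = 0.
  apply/eqP; apply: contraT => rt0.
  have rt0_gt0 : 0 < ray t0 i j by rewrite lt_def rt0 ray_ge0.
  have eps0 : 0 < ray t0 i j / L by rewrite divr_gt0.
  have [u Zu] := sup_adherent eps0 supZ; rewrite -/t0.
  have u_le : u <= t0 by exact: sup_upper_bound.
  have [_ _ ru] := Zu; have := ray_lipschitz u t0 i j.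
  rewrite ru subr0 ger0_norm// ger0_norm ?subr_ge0// -/L => h1 h2.
  have : t0 - u < ray t0 i j / L by lra.
  by rewrite ltr_pdivlMr// => /lt_le_trans/(_ h1); rewrite ltxx. 
have t0_gt0 : 0 < t0.
  rewrite lt_def (le_trans s0 st0) andbT; apply/eqP => t00.
  by have := ray0_gt0 i j; move: rt0; rewrite t00 => ->; rewrite ltxx.
have t0_lt : t0 < t.
  by rewrite lt_def t0t andbT; apply: contraNneq rt => ->; rewrite rt0.
have after u : t0 < u -> u < t -> 0 < ray u i j.
  move=> t0u ut; rewrite lt_def ray_ge0 andbT; apply/eqP => ru.
  have : u <= t0 by apply: sup_upper_bound => //; split=> //; lra.
  lra.
have [S SP] := ray_support_frequent t0.
have [u2 [t0u2 u2t u2S]] := SP t t0_lt.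
have ru2 := after _ t0u2 u2t.
(* Comparison with [u2] bounds the entry at [u1] below by [t0 * ray u2 i j / u2], while the
   Lipschitz bound from [t0] gives less than [d * L], the same number. *)
pose d := t0 * ray u2 i j / (u2 * L).
have u2_gt0 : 0 < u2 by lra.
have d0 : 0 < d by rewrite divr_gt0 ?mulr_gt0.
have t0_min : t0 < Num.min u2 (t0 + d) by rewrite lt_min t0u2 ltrDl.
have [u1 [t0u1 u1_lt u1S]] := SP _ t0_min.
move: u1_lt; rewrite lt_min => /andP[u12 u1d].
have u12S a b : (ray u1 a b == 0) = (ray u2 a b == 0).
  by move/setP/(_ (a, b)): u1S; rewrite -u2S !inE.
have := ray_same_support N4 (lt_trans t0_gt0 t0u1) u12 u12S i j.
have := ray_lipschitz t0 u1 i j; rewrite rt0 subr0 -/L.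
rewrite (ger0_norm (ray_ge0 _ _ _)) ger0_norm ?subr_ge0 ?(ltW t0u1)// => h.
have : (u1 - t0) * L < d * L by rewrite ltr_pM2r//; lra.
have -> : d * L = t0 * ray u2 i j / u2 by rewrite /d; field; rewrite !gt_eqF.
rewrite ltr_pdivlMr// => h2.
have : u2 * ray u1 i j <= (u1 - t0) * L * u2 by rewrite mulrC ler_pM2r.
have : t0 * ray u2 i j <= u1 * ray u2 i j by rewrite ler_pM2r// ltW.
lra.
Qed.

Lemma ray_is_cvg : cvg (ray t @[t --> +oo]).
Proof.
exact: (nearest_ray_is_cvg (@birkhoff_convex R N) ray_nearest
  (@birkhoff_energy R N)).
Qed.

End BirkhoffRay.

Lemma birkhoff_monotone (R : realType) (N : nat) : (N <= 4)%N ->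
  monotone_polytope (@birkhoff R N).
Proof.
move=> N4 c F faceF eta eta' eta0 eta_le.
have [ray rayE] : exists ray, ray = fun t => Defs.proj (@birkhoff R N) (- (t *: c)).
  by eexists.
have ray_nearest t : is_nearest_point (@birkhoff R N) (- (t *: c)) (ray t).
  by rewrite rayE; apply: proj_nearest;
    [exact: birkhoff_convex|exact: birkhoff_nearest].
have curveE r : proj_curve (@birkhoff R N) c r%:E = ray r by rewrite rayE.
have curve_pinfty : proj_curve (@birkhoff R N) c +oo%E = lim (ray t @[t --> +oo]).
  by rewrite rayE.
case: eta eta0 eta_le => [s| |//]; last by case: eta'.
rewrite lee_fin curveE => s0 s_eta' Fs.
have supp t i j : s <= t -> ray s i j = 0 -> ray t i j = 0.
  by move=> st; exact: (ray_support_decreasing ray_nearest).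
case: eta' s_eta' => [t| _|//].
  rewrite lee_fin curveE => st; apply: (face_absorbs faceF Fs) => [|i j].
    exact: (ray_birkhoff ray_nearest).
  exact: supp.
(* At infinity, membership in the polytope and the vanishing of entries pass to the limit. *)
rewrite curve_pinfty; have cvg_ray := ray_is_cvg ray_nearest.
apply: (face_absorbs faceF Fs) => [|i j ray0].
  apply: (closed_cvg _ (@closed_birkhoff R N) _ _ cvg_ray).
  by near=> t; exact: (ray_birkhoff ray_nearest).
have cvg_ij := cvg_comp _ _ cvg_ray
  (@coord_continuous R N N i j (lim (ray t @[t --> +oo]))).
apply: (@closed_cvg _ _ +oo _ (fun t => ray t i j) _ (@closed_eq R 0)
  _ _ cvg_ij).
near=> t; apply: supp ray0; near: t; apply: nbhs_pinfty_ge; exact: num_real.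
Unshelve. all: by end_near. Qed.

(** * Failure of monotonicity *)

Lemma sum_marginals (R : realType) N (u v : 'I_N -> R) (y : 'M[R]_N) :
  birkhoff y -> \sum_i \sum_j (u i + v j) * y i j = \sum_i u i + \sum_j v j.
Proof.
move=> [yc yr _].
have -> : \sum_i \sum_j (u i + v j) * y i j =
    \sum_i \sum_j u i * y i j + \sum_i \sum_j v j * y i j.
  rewrite -big_split/=; apply: eq_bigr => i _; rewrite -big_split/=.
  by apply: eq_bigr => j _; rewrite mulrDl.
congr (_ + _).
  by apply: eq_bigr => i _; rewrite -mulr_sumr yr mulr1.
by rewrite exchange_big/=; apply: eq_bigr => j _; rewrite -mulr_sumr yc mulr1.
Qed.

(** Linear programming duality: [u] and [v] bound [<x - z, y>] from below over the polytope, and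
    complementary slackness makes the bound exact at [x]. *)
Lemma dual_nearest (R : realType) N (x z : 'M[R]_N) (u v : 'I_N -> R) :
  birkhoff x -> (forall i j, u i + v j <= x i j - z i j) ->
  (forall i j, x i j != 0 -> x i j - z i j = u i + v j) ->
  is_nearest_point (@birkhoff R N) z x.
Proof.
move=> Px le_uv eq_uv; apply: variational_nearest => // y Py.
rewrite frob_innerDr frob_innerNr subr_ge0.
apply: (@le_trans _ _ (\sum_i u i + \sum_j v j)).
  rewrite -(sum_marginals u v Px) /frob_inner.
  apply: ler_sum => i _; apply: ler_sum => j _; rewrite !mxE.
  have [->|/eq_uv->] := eqVneq (x i j) 0; first by rewrite !mulr0.
  by rewrite lexx.
have [_ _ y0] := Py; rewrite -(sum_marginals u v Py).
by apply: ler_sum => i _; apply: ler_sum => j _; rewrite !mxE ler_wpM2r.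
Qed.

(** * The counterexample on an arrow-shaped support *)

Section Arrow.
Variables (R : realType) (N : nat) (i0 : 'I_N).

Definition arrow (a b d : R) : 'M[R]_N := \matrix_(i, j)
  if i == i0 then if j == i0 then a else b
  else if j == i0 then b else if i == j then d else 0.

Lemma arrow_birkhoff a b d : 0 <= a -> 0 <= b -> 0 <= d ->
  a + (N%:R - 1) * b = 1 -> b + d = 1 -> birkhoff (arrow a b d).
Proof.
move=> a0 b0 d0 ab bd.
have N0 : (0 < N)%N := leq_ltn_trans (leq0n _) (ltn_ord i0).
have arrowC i j : arrow a b d i j = arrow a b d j i.
  by rewrite !mxE [i == j]eq_sym; case: (i == i0); case: (j == i0).
have row_sum i : \sum_j arrow a b d i j = 1.
  under eq_bigr do rewrite mxE.
  have [_|i_neq] := eqVneq i i0.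
    rewrite (bigD1 i0)//= eqxx (eq_bigr (fun=> b)) => [|j /negPf->//].
    rewrite sumr_const cardC1 card_ord -[RHS]ab -[b *+ _]mulr_natl.
    congr (_ + _ * _).
    by rewrite -[in RHS](prednK N0) -natr1 addrK.
  rewrite (bigD1 i0)//= eqxx (bigD1 i)//= (negPf i_neq) eqxx addrA big1 ?addr0//.
  by move=> j /andP[/negPf-> /negPf]; rewrite eq_sym => ->.
split=> [j|i|i j]; [|exact: row_sum|].
  by rewrite -[RHS](row_sum j); apply: eq_bigr => i _.
by rewrite mxE; do ![case: ifP => _].
Qed.

(** A zero corner and the unit marginals determine the other two parameters. *)
Definition arrow_start := arrow 0 (N%:R - 1)^-1 (1 - (N%:R - 1)^-1).

(* [arrow ((4 - N) / (N + 2)) (2 / (N + 2)) (N / (N + 2))] is the point of minimal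
   norm of the affine hull of the matrices supported on the arrow; its corner is
   negative for [N > 4]. This is twice [arrow_start] minus that point. *)
Definition arrow_end := arrow ((N%:R - 4) / (N%:R + 2))
  (2 * (N%:R - 1)^-1 - 2 / (N%:R + 2))
  (2 - 2 * (N%:R - 1)^-1 - N%:R / (N%:R + 2)).

(** Chosen to make [arrow_start + arrow_cost] constant, so that [arrow_start] is the projection at
    time 1; the constant 1 makes the cost nonnegative. *)
Definition arrow_cost : 'M[R]_N := const_mx 1 - arrow_start.

Hypothesis N5 : (5 <= N)%N.

Let N5R : 5 <= N%:R :> R. Proof. by rewrite ler_nat. Qed.

Lemma arrow_start_birkhoff : birkhoff arrow_start.
Proof.
have ? := N5R; have N1 : 0 < N%:R - 1 :> R by lra.
have N1' : (N%:R - 1)^-1 <= 1 :> R by rewrite invf_le1//; lra.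
apply: arrow_birkhoff => //; first by rewrite invr_ge0 ltW.
- by rewrite subr_ge0.
- by rewrite add0r mulfV// gt_eqF.
- by rewrite addrC subrK.
Qed.

Lemma arrow_end_birkhoff : birkhoff arrow_end.
Proof.
have ? := N5R; have N1 : 0 < N%:R - 1 :> R by lra.
have N2 : 0 < N%:R + 2 :> R by lra.
have le_inv : (N%:R + 2)^-1 <= (N%:R - 1)^-1 :> R by rewrite lef_pV2 ?posrE//; lra.
have inv_le : (N%:R - 1)^-1 <= 4^-1 :> R by rewrite lef_pV2 ?posrE//; lra.
apply: arrow_birkhoff.
- by rewrite divr_ge0 ?(ltW N2)//; lra.
- lra.
- have : N%:R / (N%:R + 2) <= 1 :> R by rewrite ler_pdivrMr// mul1r; lra.
  lra.
- by field; rewrite !gt_eqF.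
- by field; rewrite !gt_eqF.
Qed.

Lemma arrow_start_nearest :
  is_nearest_point (@birkhoff R N) (- (1 *: arrow_cost)) arrow_start.
Proof.
apply: (@dual_nearest _ _ _ _ (fun=> 1) (fun=> 0)) => [|i j|i j _].
- exact: arrow_start_birkhoff.
- by rewrite /arrow_cost !mxE; lra.
- by rewrite /arrow_cost !mxE; lra.
Qed.

Lemma arrow_end_nearest :
  is_nearest_point (@birkhoff R N) (- (2 *: arrow_cost)) arrow_end.
Proof.
have ? := N5R; have N1 : N%:R - 1 != 0 :> R by rewrite gt_eqF//; lra.
have N2 : N%:R + 2 != 0 :> R by rewrite gt_eqF//; lra.
have N2_gt0 : 0 < N%:R + 2 :> R by lra.
(* The residual at time 2 is 2 minus the point of minimal norm, which on the arrow is the sum of a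
   row term and the same column term; [u] is read off from these. *)
pose u (i : 'I_N) : R := 1 - (if i == i0 then 4 - N%:R else N%:R) / (2 * (N%:R + 2)).
have uE i j : u i + u j = 2 - ((if i == i0 then 4 - N%:R else N%:R) +
    (if j == i0 then 4 - N%:R else N%:R)) / (2 * (N%:R + 2)).
  by rewrite /u; field.
have diffE i j : arrow_end i j - (- (2 *: arrow_cost)) i j = 2 -
    arrow ((4 - N%:R) / (N%:R + 2)) (2 / (N%:R + 2)) (N%:R / (N%:R + 2)) i j.
  rewrite /arrow_cost !mxE.
  by case: (i == i0); case: (j == i0); case: (i == j); field; rewrite ?N1 ?N2.
have E1 : ((4 - N%:R) + (4 - N%:R)) / (2 * (N%:R + 2)) =
    (4 - N%:R) / (N%:R + 2) :> R by field.
have E2 : ((4 - N%:R) + N%:R) / (2 * (N%:R + 2)) = 2 / (N%:R + 2) :> R by field.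
have E3 : (N%:R + (4 - N%:R)) / (2 * (N%:R + 2)) = 2 / (N%:R + 2) :> R by field.
have E4 : (N%:R + N%:R) / (2 * (N%:R + 2)) = N%:R / (N%:R + 2) :> R by field.
apply: (@dual_nearest _ _ _ _ u u) => [|i j|i j].
- exact: arrow_end_birkhoff.
- rewrite diffE uE lerD2l lerN2 mxE.
  case: (i == i0); case: (j == i0); rewrite ?E1 ?E2 ?E3 ?E4//.
  by case: (i == j); rewrite // divr_ge0// ltW.
- rewrite diffE uE !mxE => S; congr (2 - _); move: S.
  case: (i == i0); case: (j == i0); rewrite ?E1 ?E2 ?E3 ?E4//.
  by case: (i == j) => //; rewrite eqxx.
Qed.

Lemma segment_ge0 (a b : R) :
  (forall t, 0 < t -> t < 1 -> 0 <= (1 - t) * a + t * b) -> 0 <= a.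
Proof.
move=> ab; rewrite leNgt; apply/negP => a0.
have half : (2^-1 : R) * 2 = 1 by rewrite mulVf.
have h0 : 0 < (2^-1 : R) by []; have h1 : (2^-1 : R) < 1 by lra.
have b0 : 0 < b by have := ab _ h0 h1; nra.
have ba : 0 < b - a by lra.
(* At this [t] the combination equals [a / 2]. *)
pose t := - a / 2 / (b - a).
have tE : t * (b - a) = - a / 2 by rewrite /t divfK// gt_eqF.
have t0 : 0 < t by rewrite !divr_gt0// oppr_gt0.
have t1 : t < 1 by rewrite /t ltr_pdivrMr//; lra.
have := ab t t0 t1; lra.
Qed.

(** Faces are tested on open segments, so the endpoints must be recovered: marginals are affine
    along the segment, hence fixed by two interior points, and nonnegativity passes to the end. *)
Lemma birkhoff_segment (x y : 'M[R]_N) :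
  open_segment x y `<=` birkhoff (N:=N) -> birkhoff x.
Proof.
move=> segP.
have inP t : 0 < t -> t < 1 -> birkhoff ((1 - t) *: x + t *: y).
  by move=> t0 t1; apply: segP; exists t => //=; rewrite in_itv/= t0.
have [h1 h2 h3 h4] :
    [/\ 0 < (3^-1 : R), (3^-1 : R) < 1, 0 < (2^-1 : R) & (2^-1 : R) < 1].
  by split; lra.
have [c1 r1 _] := inP _ h1 h2; have [c2 r2 _] := inP _ h3 h4.
have sumE (f : 'I_N -> 'I_N * 'I_N) t :
    \sum_k ((1 - t) *: x + t *: y) (f k).1 (f k).2 =
    (1 - t) * \sum_k x (f k).1 (f k).2 + t * \sum_k y (f k).1 (f k).2.
  rewrite !mulr_sumr -big_split/=; apply: eq_bigr => k _.
  by rewrite !mxE.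
split=> [j|i|i j].
- have := c1 j; have := c2 j.
  by rewrite !(sumE (fun k => (k, j)))/=; lra.
- have := r1 i; have := r2 i.
  by rewrite !(sumE (fun k => (i, k)))/=; lra.
- apply: (@segment_ge0 _ (y i j)) => t t0 t1.
  by have [_ _ /(_ i j)] := inP t t0 t1; rewrite !mxE.
Qed.

Lemma arrow_not_monotone : ~ monotone_polytope (@birkhoff R N).
Proof.
have ? := N5R; have N2_gt0 : 0 < N%:R + 2 :> R by lra.
(* The facet where the corner vanishes contains the projection at time 1 but not the one at time
   2. *)
pose F := [set p : 'M[R]_N | birkhoff p /\ p i0 i0 = 0].
have faceF : is_face (@birkhoff R N) F.
  split=> [x y k|p []//|x y segP [p [[t]]]].
    rewrite !inE => -[Px x0] [Py y0].
    have E : conv k x y = x + (1 - k%:num) *: (y - x).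
      by rewrite /conv/=; apply/matrixP => i j; rewrite !mxE /unstable.onem; ring.
    rewrite E; split; last by rewrite !mxE x0 y0 subrr mulr0 addr0.
    exact: birkhoff_convex.
  rewrite /= in_itv/= => /andP[t0 t1] <- [_ p0].
  have Px := birkhoff_segment segP.
  have Py : birkhoff y.
    apply: (@birkhoff_segment y x) => w [s].
    rewrite /= in_itv/= => /andP[s0 s1] <-; apply: segP; exists (1 - s).
      by rewrite /= in_itv/= subr_gt0 s1 ltrBlDr ltrDl.
    by rewrite subKr addrC.
  have [_ _ /(_ i0 i0) x0] := Px; have [_ _ /(_ i0 i0) y0] := Py.
  rewrite !mxE in p0.
  have xx0 : x i0 i0 = 0 by nra.
  have yy0 : y i0 i0 = 0 by nra.
  move=> w [s]; rewrite /= in_itv/= => /andP[s0 s1] <-; split.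
    rewrite (_ : _ + _ = x + s *: (y - x)); first exact: birkhoff_convex.
    by rewrite scalerBl scale1r scalerBr addrA addrAC.
  by rewrite !mxE xx0 yy0 !mulr0 addr0.
move=> /(_ arrow_cost F faceF 1%:E 2%:E); rewrite !lee_fin ler01 ler1n.
move=> /(_ isT isT); rewrite /proj_curve.
rewrite (projE (@birkhoff_convex R N) arrow_start_nearest).
rewrite (projE (@birkhoff_convex R N) arrow_end_nearest).
case; first by split; [exact: arrow_start_birkhoff|rewrite mxE eqxx].
by move=> _; rewrite mxE eqxx => /eqP; rewrite gt_eqF// divr_gt0//; lra.
Qed.

End Arrow.

(** * Couplings of empirical measures *)

Section FiniteSupport.
Context d (T : measurableType d) (R : realType) (I : finType) (f : I -> T).
Hypothesis mf : forall i, measurable [set f i].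
Local Open Scope ereal_scope.

Lemma range_bigsetU : range f = \big[setU/set0]_(i <- enum I) [set f i].
Proof.
rewrite -bigcup_seq; apply/seteqP; split=> [x [i _ <-]|x [i _ ->]].
  by exists i => //=; rewrite mem_enum.
by exists i.
Qed.

Lemma measurable_range : measurable (range f).
Proof. by rewrite range_bigsetU; exact: bigsetU_measurable. Qed.

Hypothesis injf : injective f.
Variables (m : {measure set T -> \bar R}).
Hypothesis m_range : m (~` range f) = 0.

Lemma ge0_integral_range (g : T -> \bar R) : measurable_fun setT g ->
  (forall x, 0 <= g x) -> \int[m]_x g x = \sum_i g (f i) * m [set f i].
Proof.
move=> mg g0.
rewrite (@ge0_negligible_integral _ _ _ _ _ (~` range f))//; last first.
  exact: measurableC measurable_range.
rewrite setTD setCK range_bigsetU ge0_integral_bigsetU//.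
- rewrite -[RHS]big_enum; apply: eq_bigr => i _.
  rewrite -integral_cst//; apply: eq_integral => x.
  by rewrite inE => ->.
- exact: enum_uniq.
- move=> i j _ _ [x [/= -> /injf]]; exact: id.
- exact: measurable_funTS.
Qed.

Lemma measure_range A : measurable A ->
  m A = \sum_i (\1_A (f i))%:E * m [set f i].
Proof.
move=> mA; rewrite -[in LHS](setIT A) -integral_indic// ge0_integral_range//.
  exact/measurable_EFinP/measurable_indic.
Qed.

End FiniteSupport.

Section AtomicMeasure.
Context d (T : measurableType d) (R : realType) (I : finType) (f : I -> T).
Local Open Scope ereal_scope.

Lemma atomic_probability (w : I -> R) : (forall i, 0 <= w i)%R ->
  (\sum_i w i = 1)%R ->
  exists p : probability T R, forall A, measurable A ->
    p A = \sum_i (\1_A (f i) * w i)%:E.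
Proof.
move=> w0 w1.
have /card_gt0P[i0 _] : (0 < #|I|)%N.
  rewrite lt0n; apply/eqP => I0; move: w1.
  rewrite big_pred0 => [/eqP|i]; first by rewrite eq_sym oner_eq0.
  by have := fintype0 i I0.
pose nngw i := NngNum (w0 i).
pose mu_ k : {measure set T -> \bar R} :=
  mscale (nngw (nth i0 (enum I) k)) (dirac (f (nth i0 (enum I) k))).
have muE A : msum mu_ #|I| A = \sum_i (\1_A (f i) * w i)%:E.
  rewrite /msum -[RHS]big_enum (big_nth i0) -cardE big_mkord.
  apply: eq_bigr => k _.
  transitivity ((w (nth i0 (enum I) k))%:E * \d_(f (nth i0 (enum I) k)) A).
    by [].
  by rewrite diracE -EFinM mulrC indicE.
have muT : msum mu_ #|I| setT = 1.
  rewrite muE -w1 sumEFin; congr (_%:E); apply: eq_bigr => i _.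
  by rewrite indicT mul1r.
(* Normalization supplies the probability structure and leaves a measure of total mass 1
   unchanged. *)
have normal (m : {measure set T -> \bar R}) (P : probability T R) :
    m setT = 1 -> mnormalize m P = m.
  move=> mT; apply/funext => A; rewrite /mnormalize mT/= gt_eqF ?lte01//=.
  by rewrite invr1 mule1.
exists (mnormalize (msum mu_ #|I|) (dirac (f i0))) => A mA.
by rewrite -muE; apply: (congr1 (fun m => m A)); exact: normal.
Qed.

End AtomicMeasure.

Section EmpiricalAtoms.
Context d (T : measurableType d) (R : realType) (N : nat) (X : 'I_N -> T).
Local Open Scope ereal_scope.

Lemma empirical_range : empirical R X (~` range X) = 0.
Proof.
rewrite /empirical big1 ?mule0// => i _; rewrite diracE memNset//.
by apply; exists i.
Qed.

Hypothesis injX : injective X.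

Lemma empirical_set1 i : empirical R X [set X i] = (N%:R^-1)%:E.
Proof.
rewrite /empirical (bigD1 i)//= diracE mem_set// big1 ?adde0 ?mule1// => j ji.
by rewrite diracE memNset// => /injX/eqP; rewrite (negPf ji).
Qed.

End EmpiricalAtoms.

(** * Couplings as doubly stochastic matrices *)

Section Couplings.
Context d1 d2 (T1 : measurableType d1) (T2 : measurableType d2) (R : realType).
Context (N : nat) (X : 'I_N -> T1) (Y : 'I_N -> T2).
Hypotheses (mT1 : forall x : T1, measurable [set x])
  (mT2 : forall y : T2, measurable [set y]).
Hypotheses (injX : injective X) (injY : injective Y) (N0 : (0 < N)%N).
Local Open Scope ereal_scope.

Let mu := empirical R X.
Let nu := empirical R Y.

Definition grid (p : 'I_N * 'I_N) := (X p.1, Y p.2).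

Let N0R : (0 < N%:R :> R)%R. Proof. by rewrite ltr0n. Qed.

Lemma grid_inj : injective grid.
Proof. by move=> [i j] [k l] [/injX-> /injY->]. Qed.

Lemma set1_grid p : [set grid p] = [set X p.1] `*` [set Y p.2].
Proof.
apply/seteqP; split=> [_ ->//|[x y] [/= -> ->]].
by [].
Qed.

Lemma measurable_grid p : measurable [set grid p].
Proof. by rewrite set1_grid; exact: measurableX. Qed.

(** The complement of the grid is covered by two null cylinders; this serves both the product
    measure and the couplings. *)
Lemma compl_range_grid (m : {measure set (T1 * T2) -> \bar R}) :
  m (fst @^-1` (~` range X)) = 0 -> m (snd @^-1` (~` range Y)) = 0 ->
  m (~` range grid) = 0.
Proof.
move=> mX0 mY0.
have mX : measurable (fst @^-1` (~` range X) : set (T1 * T2)).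
  rewrite -[X in measurable X]setTI; apply: measurable_fst => //.
  exact: measurableC (measurable_range (fun i => mT1 (X i))).
have mY : measurable (snd @^-1` (~` range Y) : set (T1 * T2)).
  rewrite -[X in measurable X]setTI; apply: measurable_snd => //.
  exact: measurableC (measurable_range (fun i => mT2 (Y i))).
apply: (@subset_measure0 _ _ _ _ _
    (fst @^-1` (~` range X) `|` snd @^-1` (~` range Y))).
- exact: measurableC (measurable_range measurable_grid).
- exact: measurableU.
- move=> [x y] /= xy; apply: contrapT => /not_orP[/contrapT[i _ xE] /contrapT[j _ yE]].
  by apply: xy; exists (i, j) => //; rewrite /grid/= xE yE.
- apply/eqP; rewrite -measure_le0; apply: le_trans (measureU2 _ mX mY) _.
  by rewrite [X in X + _]mX0 [X in _ + X]mY0 adde0.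
Qed.

Lemma product_empirical_grid p :
  product_finite mu nu [set grid p] = (N%:R^-1 * N%:R^-1)%:E.
Proof.
rewrite set1_grid /product_finite product_measure1E// EFinM.
by congr (_ * _); exact: empirical_set1.
Qed.

Lemma product_empirical_range : product_finite mu nu (~` range grid) = 0.
Proof.
have mXc : measurable (~` range X).
  exact: measurableC (measurable_range (fun i => mT1 (X i))).
have mYc : measurable (~` range Y).
  exact: measurableC (measurable_range (fun i => mT2 (Y i))).
have muX : mu (~` range X) = 0 by exact: empirical_range.
have nuY : nu (~` range Y) = 0 by exact: empirical_range.
apply: compl_range_grid.
- rewrite -setXT; transitivity (mu (~` range X) * nu setT).
    exact: product_measure1E.
  by rewrite muX mul0e.
- rewrite -setTX; transitivity (mu setT * nu (~` range Y)).
    exact: product_measure1E.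
  by rewrite nuY mule0.
Qed.

Lemma coupling_range g : coupling mu nu g -> g (~` range grid) = 0.
Proof.
move=> [g1 g2]; apply: compl_range_grid.
  have mX := measurableC (measurable_range (fun i => mT1 (X i))).
  exact: etrans (g1 _ mX) (empirical_range R X).
have mY := measurableC (measurable_range (fun i => mT2 (Y i))).
exact: etrans (g2 _ mY) (empirical_range R Y).
Qed.

(** The factor [N] turns the marginal masses [1 / N] into unit row and column sums. *)
Definition plan_matrix (g : probability (T1 * T2)%type R) : 'M[R]_N :=
  \matrix_(i, j) (N%:R * fine (g [set grid (i, j)]))%R.

Lemma plan_matrixE (g : probability (T1 * T2)%type R) i j :
  g [set grid (i, j)] = (N%:R^-1 * plan_matrix g i j)%:E.
Proof.
rewrite mxE mulKf ?gt_eqF// fineK//; apply: fin_num_measure.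
exact: measurable_grid.
Qed.

Lemma coupling_birkhoff g : coupling mu nu g -> birkhoff (plan_matrix g).
Proof.
move=> cg; have [g1 g2] := cg.
have gE A (mA : measurable A) :=
  measure_range measurable_grid grid_inj (coupling_range cg) mA.
have row_sum i : (\sum_j plan_matrix g i j = 1)%R.
  have := etrans (g1 _ (mT1 (X i))) (empirical_set1 R injX i).
  rewrite /pushforward gE; last first.
    by rewrite -[X in measurable X]setTI; apply: measurable_fst.
  rewrite -(pair_bigA _ (fun k j =>
    (\1_(fst @^-1` [set X i]) (grid (k, j)))%:E * g [set grid (k, j)]))/=.
  rewrite (bigD1 i)//= [X in _ + X]big1 ?adde0 => [|k ki]; last first.
    rewrite big1// => j _; rewrite indicE memNset ?mul0e//=.
    by move=> /injX/eqP; rewrite (negPf ki).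
  under eq_bigr do rewrite indicE mem_set// mul1e plan_matrixE.
  rewrite sumEFin -mulr_sumr => -[] /(congr1 (fun z => N%:R * z)%R).
  by rewrite mulrA mulfV ?gt_eqF// mul1r.
have col_sum j : (\sum_i plan_matrix g i j = 1)%R.
  have := etrans (g2 _ (mT2 (Y j))) (empirical_set1 R injY j).
  rewrite /pushforward gE; last first.
    by rewrite -[X in measurable X]setTI; apply: measurable_snd.
  rewrite -(pair_bigA _ (fun i k =>
    (\1_(snd @^-1` [set Y j]) (grid (i, k)))%:E * g [set grid (i, k)]))/=.
  under eq_bigr => i _.
    rewrite (bigD1 j)//= [X in _ + X]big1 ?adde0 => [|k kj]; last first.
      rewrite indicE memNset ?mul0e//=.
      by move=> /injY/eqP; rewrite (negPf kj).
    rewrite indicE mem_set// mul1e plan_matrixE.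
    over.
  rewrite sumEFin -mulr_sumr => -[] /(congr1 (fun z => N%:R * z)%R).
  by rewrite mulrA mulfV ?gt_eqF// mul1r.
by split=> // i j; rewrite mxE mulr_ge0// fine_ge0.
Qed.

Lemma birkhoff_coupling x : birkhoff x ->
  exists2 g, coupling mu nu g & plan_matrix g = x.
Proof.
move=> [xc xr x0].
have sumx : (\sum_(p : 'I_N * 'I_N) N%:R^-1 * x p.1 p.2 = 1)%R.
  rewrite -(pair_bigA _ (fun i j => N%:R^-1 * x i j)%R)/=.
  under eq_bigr do rewrite -mulr_sumr xr mulr1.
  by rewrite sumr_const card_ord -[RHS](@mulVf _ N%:R) ?gt_eqF// mulr_natr.
have w0 (p : 'I_N * 'I_N) : (0 <= N%:R^-1 * x p.1 p.2)%R.
  by rewrite mulr_ge0// invr_ge0 ltW.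
have [g gE] := atomic_probability grid w0 sumx.
exists g; last first.
  apply/matrixP => i j; rewrite mxE gE; last exact: measurable_grid.
  rewrite (bigD1 (i, j))//= big1 ?adde0 => [|p pij].
    by rewrite indicE mem_set// mul1r/= mulrA mulfV ?gt_eqF// mul1r.
  by rewrite indicE memNset ?mul0r// => /grid_inj/eqP; rewrite (negPf pij).
split=> [A mA|B mB].
- rewrite /pushforward gE; last first.
    by rewrite -[X in measurable X]setTI; apply: measurable_fst.
  rewrite sumEFin -(pair_bigA _ (fun i j =>
    \1_(fst @^-1` A) (grid (i, j)) * (N%:R^-1 * x i j))%R)/=.
  transitivity ((\sum_i N%:R^-1 * \1_A (X i) : R)%R%:E).
    congr (_%:E); apply: eq_bigr => i _.
    rewrite (eq_bigr (fun j => \1_A (X i) * (N%:R^-1 * x i j))%R)//.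
    by rewrite -!mulr_sumr xr mulr1 mulrC.
  rewrite -mulr_sumr EFinM -sumEFin -[RHS]/(empirical R X A) /empirical.
  by congr (_ * _); apply: eq_bigr => i _; rewrite diracE indicE.
- rewrite /pushforward gE; last first.
    by rewrite -[X in measurable X]setTI; apply: measurable_snd.
  rewrite sumEFin -(pair_bigA _ (fun i j =>
    \1_(snd @^-1` B) (grid (i, j)) * (N%:R^-1 * x i j))%R)/= exchange_big/=.
  transitivity ((\sum_j N%:R^-1 * \1_B (Y j) : R)%R%:E).
    congr (_%:E); apply: eq_bigr => j _.
    rewrite (eq_bigr (fun i => \1_B (Y j) * (N%:R^-1 * x i j))%R)//.
    by rewrite -!mulr_sumr xc mulr1 mulrC.
  rewrite -mulr_sumr EFinM -sumEFin -[RHS]/(empirical R Y B) /empirical.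
  by congr (_ * _); apply: eq_bigr => j _; rewrite diracE indicE.
Qed.

(** The product measure charges every grid point, so its null sets miss the grid, which carries the
    coupling. *)
Lemma coupling_dominated g : coupling mu nu g ->
  charge_of_finite_measure g `<< product_finite mu nu.
Proof.
move=> cg A A0 B mB BA /=; change (g B = 0).
have B0 : product_finite mu nu B = 0 by exact: A0.
rewrite (measure_range measurable_grid grid_inj (coupling_range cg) mB) big1// => p _.
rewrite indicE; have [pB|pB] := boolP (grid p \in B); last by rewrite mul0e.
have pB' : [set grid p] `<=` B by move=> _ ->; rewrite -inE.
have : product_finite mu nu [set grid p] = 0.
  exact: subset_measure0 (measurable_grid p) mB pB' B0.
rewrite product_empirical_grid => /eqP.
by rewrite eqe mulf_eq0 invr_eq0 orbb gt_eqF.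
Qed.

(** At a grid point the density is a mass [P / N] over [1 / N^2], that is [N * P], so its squared
    norm is the sum of the squares of the entries [P]. *)
Lemma plan_objective (c : T1 -> T2 -> R) eta g : coupling mu nu g ->
  (forall x y, 0 <= c x y)%R ->
  measurable_fun setT (fun z : T1 * T2 => c z.1 z.2) ->
  qot_objective mu nu c eta g =
  ((2 * eta)^-1 * frob_inner (plan_matrix g) (plan_matrix g) +
   N%:R^-1 * frob_inner (\matrix_(i, j) c (X i) (Y j)) (plan_matrix g))%:E.
Proof.
move=> cg c0 mc; rewrite /qot_objective.
rewrite (ge0_integral_range measurable_grid grid_inj (coupling_range cg)); last 2 first.
- exact/measurable_EFinP.
- by move=> z; rewrite lee_fin.
have dom := coupling_dominated cg.
set f := Radon_Nikodym _ _.
have fE i j : f (grid (i, j)) = (N%:R * plan_matrix g i j)%:E.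
  have ffin : f (grid (i, j)) \is a fin_num by exact: Radon_Nikodym_fin_num.
  have : g [set grid (i, j)] = f (grid (i, j)) * product_finite mu nu [set grid (i, j)].
    rewrite -integral_cst; last exact: measurable_grid.
    rewrite [LHS](Radon_Nikodym_integral dom (measurable_grid (i, j))).
    by apply: eq_integral => z; rewrite inE => ->.
  rewrite plan_matrixE product_empirical_grid -(fineK ffin) -EFinM => -[E].
  congr (_%:E); rewrite -[LHS](mulfK (_ : N%:R^-1 * N%:R^-1 != 0)%R).
    by rewrite -E invfM invrK; field; rewrite gt_eqF.
  by rewrite mulf_neq0// invr_neq0// gt_eqF.
set L := Lnorm _ _ _.
have norm2 : L `^ 2 = (frob_inner (plan_matrix g) (plan_matrix g))%:E.
  rewrite /L poweR_Lnorm//.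
  rewrite (ge0_integral_range measurable_grid grid_inj
    product_empirical_range)//; last 2 first.
  - apply: (measurableT_comp (measurable_poweR 2)).
    apply: measurableT_comp => //.
    exact: measurable_int (Radon_Nikodym_integrable dom).
  - by move=> z; exact: poweR_ge0.
  rewrite -(pair_bigA _ (fun i j =>
    `|f (grid (i, j))| `^ 2 * product_finite mu nu [set grid (i, j)]))/=.
  rewrite /frob_inner -sumEFin; apply: eq_bigr => i _.
  rewrite -sumEFin; apply: eq_bigr => j _.
  rewrite product_empirical_grid fE/= ?poweR_EFin powR_mulrn// -EFinM; congr (_%:E).
  by rewrite real_normK ?num_real//; field; rewrite gt_eqF.
have -> : L ^+ 2 = (frob_inner (plan_matrix g) (plan_matrix g))%:E.
  have : 0 <= L by exact: Lnorm_ge0.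
  move: norm2; case: L => [r||].
  - by rewrite poweR_EFin lee_fin => + r0; rewrite powR_mulrn// EFin_expe.
  - by rewrite poweRE pnatr_eq0.
  - by rewrite leeNy_eq.
rewrite addeC -EFinM EFinD; congr (_ + _).
rewrite -(pair_bigA _ (fun i j => (c (X i) (Y j))%:E * g [set grid (i, j)]))/=.
rewrite /frob_inner mulr_sumr -sumEFin; apply: eq_bigr => i _.
rewrite mulr_sumr -sumEFin; apply: eq_bigr => j _.
by rewrite plan_matrixE -EFinM !mxE; congr (_%:E); ring.
Qed.

(* [N *] the matrix of an optimal plan minimizes
   [<C, y> + N / (2 eta) * |y|^2] over the Birkhoff polytope, so it is the
   projection with parameter [eta / N]. *)
Lemma qot_plan_matrix (c : T1 -> T2 -> R) t x : (0 < t)%R ->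
  (forall a b, 0 <= c a b)%R ->
  measurable_fun setT (fun z : T1 * T2 => c z.1 z.2) ->
  is_nearest_point (@birkhoff R N)
    (- (t *: \matrix_(i, j) c (X i) (Y j)))%R x ->
  plan_matrix (qot_plan mu nu c (N%:R * t)) = x.
Proof.
move=> t0 c0 mc; set C := (\matrix_(i, j) c (X i) (Y j))%R => xnear.
have objP g g' : coupling mu nu g -> coupling mu nu g' ->
    (qot_objective mu nu c (N%:R * t) g <= qot_objective mu nu c (N%:R * t) g') =
    (frob_norm (plan_matrix g - - (t *: C)) <=
     frob_norm (plan_matrix g' - - (t *: C)))%R.
  move=> cg cg'; rewrite !plan_objective// lee_fin frob_norm_le.
  move: (plan_matrix g) (plan_matrix g') => y y'.
  (* Completing the square: up to a positive factor and a constant, the objective is the squared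
     distance to [- (t *: C)]. *)
  have objE z : ((2 * (N%:R * t))^-1 * frob_inner z z + N%:R^-1 * frob_inner C z =
      (2 * (N%:R * t))^-1 * (frob_inner (z - - (t *: C)) (z - - (t *: C)) -
        t ^+ 2 * frob_inner C C))%R.
    rewrite opprK frob_innerDl !frob_innerDr !frob_innerZl !frob_innerZr.
    rewrite [frob_inner z C]frob_innerC; field.
    by rewrite !gt_eqF.
  by rewrite -/C !objE ler_pM2l ?lerD2r// invr_gt0 !mulr_gt0.
(* The nearest point lifts to a minimizing coupling, so [get] does select a minimizer. *)
have [g0 cg0 g0x] := birkhoff_coupling xnear.1.
have : is_qot_minimizer mu nu c (N%:R * t) (qot_plan mu nu c (N%:R * t)).
  apply: (@xgetPex _ point [set g | is_qot_minimizer mu nu c (N%:R * t) g]).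
  exists g0; split=> // g cg; rewrite objP// g0x.
  exact: xnear.2 (coupling_birkhoff cg).
set g := qot_plan _ _ _ _ => -[cg gmin].
apply: (nearest_unique (@birkhoff_convex R N) _ xnear).
split=> [|y Py]; first exact: coupling_birkhoff.
have [g' cg' <-] := birkhoff_coupling Py.
by rewrite -objP//; exact: gmin.
Qed.

Lemma optimal_supportP (c : T1 -> T2 -> R) t x i j : (0 < t)%R ->
  (forall a b, 0 <= c a b)%R ->
  measurable_fun setT (fun z : T1 * T2 => c z.1 z.2) ->
  is_nearest_point (@birkhoff R N)
    (- (t *: \matrix_(i, j) c (X i) (Y j)))%R x ->
  optimal_support X Y c (N%:R * t) (X i, Y j) <-> (0 < x i j)%R.
Proof.
move=> t0 c0 mc /(qot_plan_matrix t0 c0 mc) planE.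
have massE k l : (0 < qot_plan mu nu c (N%:R * t) [set (X k, Y l)]) = (0 < x k l)%R.
  by rewrite (plan_matrixE _ k l) planE lte_fin pmulr_rgt0// invr_gt0.
split=> [[k [l [[/injX-> /injY->]]]]|xij]; first by rewrite massE.
by exists i, j; split=> //; rewrite massE.
Qed.

(** Sum the indicators of the grid points weighted by [C]; singletons are measurable. *)
Lemma matrix_cost (C : 'M[R]_N) : (forall i j, 0 <= C i j)%R ->
  exists c : T1 -> T2 -> R, [/\ (forall a b, 0 <= c a b)%R,
    measurable_fun setT (fun z : T1 * T2 => c z.1 z.2) &
    (\matrix_(i, j) c (X i) (Y j))%R = C].
Proof.
move=> C0.
exists (fun a b => \sum_i \sum_j C i j * (\1_[set X i] a * \1_[set Y j] b))%R; split.
- move=> a b; apply: sumr_ge0 => i _; apply: sumr_ge0 => j _.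
  by rewrite mulr_ge0// mulr_ge0// indicE.
- apply: measurable_sum => i; apply: measurable_sum => j.
  apply: measurable_funM => //; apply: measurable_funM.
    by apply: (measurableT_comp (measurable_indic (mT1 (X i)))).
  by apply: (measurableT_comp (measurable_indic (mT2 (Y j)))).
- apply/matrixP => i j; rewrite mxE (bigD1 i)//= [X in (_ + X)%R]big1 ?addr0.
    rewrite (bigD1 j)//= [X in (_ + X)%R]big1 ?addr0.
      by rewrite !indicE !mem_set// !mulr1.
    move=> l lj; rewrite [\1_[set Y l] _]indicE memNset ?mulr0// => /injY/eqP.
    by rewrite eq_sym (negPf lj).
  move=> k ki; rewrite big1// => l _.
  rewrite [\1_[set X k] _]indicE memNset ?mul0r ?mulr0// => /injX/eqP.
  by rewrite eq_sym (negPf ki).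
Qed.

(** The corner atom is absent at [eta = N] and present at [eta = 2 N], the images of the times 1 and
    2 of the arrow. *)
Lemma support_not_decreasing : (5 <= N)%N ->
  exists c : T1 -> T2 -> R, ~ support_decreasing X Y c.
Proof.
move=> N5; pose i0 := Ordinal N0.
have cost0 i j : (0 <= arrow_cost R i0 i j)%R.
  have -> : arrow_cost R i0 i j = (1 - arrow_start R i0 i j)%R by rewrite !mxE.
  by rewrite subr_ge0; apply: birkhoff_le1; exact: arrow_start_birkhoff.
have [c [c0 mc cE]] := matrix_cost cost0; exists c => decr.
have start_near := arrow_start_nearest R i0 N5; rewrite -cE in start_near.
have end_near := arrow_end_nearest R i0 N5; rewrite -cE in end_near.
have N5R : (5 <= N%:R :> R)%R by rewrite ler_nat.
have endS : optimal_support X Y c (N%:R * 2) (X i0, Y i0).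
  apply/(optimal_supportP i0 i0 _ c0 mc end_near) => //.
  by rewrite mxE eqxx divr_gt0//; lra.
have : optimal_support X Y c (N%:R * 1) (X i0, Y i0).
  by apply: decr endS; rewrite ?mulr1// ler_peMr// ler1n.
move/(optimal_supportP i0 i0 ltr01 c0 mc start_near).
by rewrite mxE eqxx ltxx.
Qed.

End Couplings.

Lemma measurable_tuple1 (R : realType) (D : nat) (x : D.-tuple R) :
  measurable [set x].
Proof.
have -> : [set x] = \bigcap_(i in [set: 'I_D])
    ((fun y : D.-tuple R => tnth y i) @^-1` [set tnth x i]).
  apply/seteqP; split=> [_ -> //|y yx].
  by apply: eq_from_tnth => i; exact: yx.
apply: fin_bigcap_measurable => // i _.
rewrite -[X in measurable X]setTI; exact: measurable_tnth.
Qed.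

Theorem theorem4p4 (R : realType) (N : nat) (N_ge1 : (1 <= N)%N) :
  [/\ ((N <= 4)%N -> monotone_polytope (@birkhoff R N)),
      ((5 <= N)%N -> ~ monotone_polytope (@birkhoff R N)) &
      ((5 <= N)%N ->
       forall (D : nat) (X Y : 'I_N -> D.-tuple R), (1 <= D)%N ->
         injective X -> injective Y ->
         exists c : D.-tuple R -> D.-tuple R -> R,
           ~ support_decreasing X Y c)].
Proof.
split=> [N4|N5|N5 D X Y _ injX injY].
- exact: birkhoff_monotone.
- exact: arrow_not_monotone (Ordinal N_ge1) N5.
- by apply: support_not_decreasing => // x; exact: measurable_tuple1.
Qed.
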